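(* Let $\beta\in(1,3/2)$. Then $K_\beta$ has an invariant probability measure of the form $m_1\otimes m_2\otimes\mu_\beta$, where $\mu_\beta$ is a probability measure on $S_\beta$ absolutely continuous with respect to the normalized Lebesgue measure $\lambda_2$ on $S_\beta$.
   Context: $\vec q_0=(0,0)$, $\vec q_1=(1,0)$, $\vec q_2=(0,1)$; $S_\beta$ is the attractor of the IFS $f_{\vec q_i}(\vec z)=(\vec z+\vec q_i)/\beta$, here the closed triangle with vertices $(0,0)$, $(\frac1{\beta-1},0)$, $(0,\frac1{\beta-1})$. Subsets of $S_\beta$: $E_0=[0,\frac1\beta)\times[0,\frac1\beta)$; $E_1=\{0\le y<\frac1\beta,\ \frac{1}{\beta(\beta-1)}<x+y\le\frac{1}{\beta-1}\}$; $E_2=\{0\le x<\frac1\beta,\ \frac{1}{\beta(\beta-1)}<x+y\le\frac{1}{\beta-1}\}$; $C_{01}=\{x\ge\frac1\beta,\ 0\le y<\frac1\beta,\ x+y\le\frac{1}{\beta(\beta-1)}\}$; $C_{12}=\{x\ge\frac1\beta,\ y\ge\frac1\beta,\ \frac{1}{\beta(\beta-1)}<x+y\le\frac{1}{\beta-1}\}$; $C_{02}=\{0\le x<\frac1\beta,\ y\ge\frac1\beta,\ x+y\le\frac{1}{\beta(\beta-1)}\}$; $C_{012}=\{x\ge\frac1\beta,\ y\ge\frac1\beta,\ x+y\le\frac{1}{\beta(\beta-1)}\}$. $\Omega=\{0,1\}^{\mathbb N}$, $\Upsilon=\{0,1,2\}^{\mathbb N}$ with product $\sigma$-algebras and left shifts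 $\sigma,\sigma'$. Fix $p\in(0,1)$, $s,t>0$, $s+t<1$; $m_1$ is the product measure on $\Omega$ with weights $p,1-p$ on symbols $0,1$; $m_2$ is the product measure on $\Upsilon$ with weights $s,t,1-s-t$ on symbols $0,1,2$. $K_\beta$ on $\Omega\times\Upsilon\times S_\beta$: $K_\beta(\omega,\upsilon,\vec z)=(\omega,\upsilon,\beta\vec z-\vec q_i)$ if $\vec z\in E_i$; $(\sigma\omega,\upsilon,\beta\vec z-\vec q_i)$ if $\omega_1=0$, $\vec z\in C_{ij}$ ($ij\in\{01,12,02\}$); $(\sigma\omega,\upsilon,\beta\vec z-\vec q_j)$ if $\omega_1=1$, $\vec z\in C_{ij}$; $(\omega,\sigma'\upsilon,\beta\vec z-\vec q_i)$ if $\vec z\in C_{012}$, $\upsilon_1=i$. *)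

(* Defs.v *)
From HB Require Import structures.
From mathcomp Require Import all_boot all_order all_algebra.
From mathcomp Require Import all_classical all_reals all_analysis.
Set Implicit Arguments. Unset Strict Implicit. Unset Printing Implicit Defensive.
Import Order.TTheory GRing.Theory Num.Theory.
Local Open Scope classical_set_scope.
Local Open Scope ring_scope.

(* Sequence spaces {0,..,k-1}^N ; coordinate n of a sequence is w n
   (w 0 is the paper's omega_1). *)
Definition seqs (k : nat) := (nat -> 'I_k.+1).
HB.instance Definition _ k := Choice.on (seqs k).
HB.instance Definition _ k := isPointed.Build (seqs k) (fun _ => ord0).

Definition coord_sets (k : nat) : set (set (seqs k)) :=
  [set A | exists (i : nat) (a : 'I_k.+1), A = [set w : seqs k | w i = a]].

Notation Seqs k := (g_sigma_algebraType (@coord_sets k)).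

Notation Omega := (Seqs 1).
Notation Upsilon := (Seqs 2).

Definition shift (k : nat) (w : Seqs k) : Seqs k := fun n => w n.+1.

Definition cyl (k n : nat) (a : 'I_n -> 'I_k.+1) : set (Seqs k) :=
  [set w | forall i : 'I_n, w (nat_of_ord i) = a i].

Definition is_product_measure {R : realType} (k : nat)
  (wt : 'I_k.+1 -> R) (m : set (Seqs k) -> \bar R) : Prop :=
  forall (n : nat) (a : 'I_n -> 'I_k.+1),
    m (cyl a) = (\prod_(i < n) wt (a i))%:E.

Definition wt1 {R : realType} (p : R) (c : 'I_2) : R :=
  if nat_of_ord c == 0%N then p else 1 - p.

Definition wt2 {R : realType} (s t : R) (c : 'I_3) : R :=
  if nat_of_ord c == 0%N then s
  else if nat_of_ord c == 1%N then t else 1 - s - t.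

Section Sbeta.
Variables (R : realType) (beta : R).
Implicit Types (x y : R).

Definition S_beta : set (R * R) :=
  [set z | 0 <= z.1 /\ 0 <= z.2 /\ z.1 + z.2 <= (beta - 1)^-1].

Let a := beta^-1.
Let c := (beta * (beta - 1))^-1.
Let e := (beta - 1)^-1.

Definition inE0 (z : R * R) : bool :=
  [&& 0 <= z.1, z.1 < a, 0 <= z.2 & z.2 < a].
Definition inE1 (z : R * R) : bool :=
  [&& 0 <= z.2, z.2 < a, c < z.1 + z.2 & z.1 + z.2 <= e].
Definition inE2 (z : R * R) : bool :=
  [&& 0 <= z.1, z.1 < a, c < z.1 + z.2 & z.1 + z.2 <= e].
Definition inC01 (z : R * R) : bool :=
  [&& a <= z.1, 0 <= z.2, z.2 < a & z.1 + z.2 <= c].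
Definition inC12 (z : R * R) : bool :=
  [&& a <= z.1, a <= z.2, c < z.1 + z.2 & z.1 + z.2 <= e].
Definition inC02 (z : R * R) : bool :=
  [&& 0 <= z.1, z.1 < a, a <= z.2 & z.1 + z.2 <= c].
Definition inC012 (z : R * R) : bool :=
  [&& a <= z.1, a <= z.2 & z.1 + z.2 <= c].

Definition qvec (i : nat) : R * R :=
  if i == 0%N then (0, 0) else if i == 1%N then (1, 0) else (0, 1).

Definition bmap (i : nat) (z : R * R) : R * R :=
  (beta * z.1 - (qvec i).1, beta * z.2 - (qvec i).2).

(* The random map K_beta on Omega x Upsilon x S_beta.  Points whose
   third coordinate lies outside S_beta (where K_beta is not defined in
   the paper) are left fixed; this is irrelevant for measures concentrated
   on Omega x Upsilon x S_beta. *)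
Definition K_beta (x : (Omega * Upsilon) * (R * R)) : (Omega * Upsilon) * (R * R) :=
  let: (wu, z) := x in
  let: (w, u) := wu in
  if inE0 z then (wu, bmap 0 z)
  else if inE1 z then (wu, bmap 1 z)
  else if inE2 z then (wu, bmap 2 z)
  else if inC01 z then
    ((shift w, u), bmap (if nat_of_ord (w 0%N) == 0%N then 0 else 1) z)
  else if inC12 z then
    ((shift w, u), bmap (if nat_of_ord (w 0%N) == 0%N then 1 else 2) z)
  else if inC02 z then
    ((shift w, u), bmap (if nat_of_ord (w 0%N) == 0%N then 0 else 2) z)
  else if inC012 z then
    ((w, shift u), bmap (nat_of_ord (u 0%N)) z)
  else x.

(* normalized two-dimensional Lebesgue measure on S_beta:
   area(S_beta) = 1 / (2 (beta-1)^2) *)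
Definition lambda2 : set (R * R) -> \bar R :=
  fun A => ((2 * (beta - 1) ^+ 2)%:E *
            ((@lebesgue_measure R) \x (@lebesgue_measure R)) (A `&` S_beta))%E.

End Sbeta.

Definition invariant_measure {d} {X : measurableType d} {R : realType}
  (T : X -> X) (P : set X -> \bar R) : Prop :=
  measurable_fun [set: X] T /\
  forall A : set X, measurable A -> P (T @^-1` A) = P A.

(* Main.v *)
From Pilot Require Import Defs.
From HB Require Import structures.
From mathcomp Require Import all_boot all_order all_algebra.
From mathcomp Require Import all_classical all_reals all_analysis.
From mathcomp Require Import measurable_realfun ring lra.
Set Implicit Arguments. Unset Strict Implicit. Unset Printing Implicit Defensive.
Import Order.TTheory GRing.Theory Num.Theory.
Import numFieldNormedType.Exports.
Local Open Scope classical_set_scope.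
Local Open Scope ring_scope.

(** Averaging over the two coin sequences turns [K_beta] into a Markov operator
    [P] on functions of the plane whose weights jump only across finitely many
    lines parallel to the sides of the triangle.  The same holds for [P^n], and
    its branches are homotheties of ratio [beta^n]; a translation by [u] along
    a coordinate axis therefore becomes a translation by [u / beta^n], up to
    the mass of strips of that width along lines of two directions.  Parallel
    strips are disjoint from their small translates, so translation regularity
    also bounds their total mass, whatever their number.  This is a
    Lasota-Yorke inequality for the variation in the two coordinate directions
    with factor [5 / beta^n], which is small for every [beta > 1].

    The images of Lebesgue measure on the unit square thus have uniformly
    bounded directional variations; averaging over translations by small squares
    shows that they are uniformly absolutely continuous.  An ultrafilter limit
    of their Cesaro means, evaluated on sets, is then countably additive,
    absolutely continuous and stationary for [P].  Finally [P] applied to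
    [z |-> (m1 \x m2) (A_z)] gives the measures of the sections of
    [K_beta^-1 A], so that stationarity under [P] is invariance of the product
    under [K_beta]. *)

(** * Bounded measurable functions and normalized positive functionals on them *)

Definition bounded_measurable {d} {T : measurableType d} {R : realType}
    (g : T -> R) :=
  measurable_fun [set: T] g /\ exists M : R, forall z, `|g z| <= M.

Section bounded_measurable.
Context {d} {T : measurableType d} {R : realType}.
Implicit Types g h : T -> R.

Lemma bm_cst (k : R) : bounded_measurable (fun _ : T => k).
Proof. by split; [exact: measurable_cst|exists `|k|]. Qed.

Lemma bm_add g h : bounded_measurable g -> bounded_measurable h ->
  bounded_measurable (fun z => g z + h z).
Proof.
move=> [mg [M gM]] [mh [N hN]]; split; first exact: measurable_funD.
exists (M + N) => z; apply: (le_trans (ler_normD _ _)).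
by rewrite lerD.
Qed.

Lemma bm_mul g h : bounded_measurable g -> bounded_measurable h ->
  bounded_measurable (fun z => g z * h z).
Proof.
move=> [mg [M gM]] [mh [N hN]]; split; first exact: measurable_funM.
by exists (M * N) => z; rewrite normrM ler_pM.
Qed.

Lemma bm_scale (k : R) g : bounded_measurable g ->
  bounded_measurable (fun z => k * g z).
Proof. exact/bm_mul/bm_cst. Qed.

Lemma bm_sum (n : nat) (F : nat -> T -> R) :
  (forall i, bounded_measurable (F i)) ->
  bounded_measurable (fun z => \sum_(i < n) F i z).
Proof.
move=> bF; elim: n => [|n IH].
  rewrite (_ : (fun _ => _) = fun=> 0); first exact: bm_cst.
  by apply/funext => z; rewrite big_ord0.
rewrite (_ : (fun _ => _) = fun z => \sum_(i < n) F i z + F n z).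
  exact: bm_add.
by apply/funext => z; rewrite big_ord_recr.
Qed.

Lemma bm_comp {d'} {U : measurableType d'} g (f : U -> T) :
  measurable_fun [set: U] f -> bounded_measurable g ->
  bounded_measurable (g \o f).
Proof.
move=> mf [mg [M gM]]; split; first exact: measurableT_comp.
by exists M => z /=.
Qed.

Lemma bm_unit g : measurable_fun [set: T] g -> (forall z, 0 <= g z <= 1) ->
  bounded_measurable g.
Proof.
move=> mg g01; split => //; exists 1 => z.
by have /andP[? ?] := g01 z; rewrite ger0_norm.
Qed.

Lemma bm_bool (b : T -> bool) : measurable_fun [set: T] b ->
  bounded_measurable (fun z => (b z)%:R : R).
Proof.
move=> mb; apply: bm_unit; last by move=> z; case: (b z); rewrite /= ?lexx ler01.
rewrite (_ : (fun _ => _) = fun z => if b z then 1 else 0); last first.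
  by apply/funext => z; case: (b z).
by apply: measurable_fun_ifT => //; exact: measurable_cst.
Qed.

End bounded_measurable.

(** Measures are handled as finitely additive means, constrained on bounded measurable functions
    only. Unlike measures, such functionals are stable under limits along an ultrafilter; countable
    additivity is recovered at the end. *)
Record mean_functional {d} {T : measurableType d} {R : realType}
    (I : (T -> R) -> R) : Prop := MeanFunctional {
  mean_add : forall g h, bounded_measurable g -> bounded_measurable h ->
    I (fun z => g z + h z) = I g + I h ;
  mean_scale : forall k g, bounded_measurable g ->
    I (fun z => k * g z) = k * I g ;
  mean_le : forall g h, bounded_measurable g -> bounded_measurable h ->
    (forall z, g z <= h z) -> I g <= I h ;
  mean_one : I (fun=> 1) = 1 }.

Section mean_functional.
Context {d} {T : measurableType d} {R : realType} (I : (T -> R) -> R).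
Hypothesis mI : mean_functional I.

Lemma mean_cst k : I (fun=> k) = k.
Proof.
rewrite (_ : (fun=> k) = fun z => k * (fun=> 1) z); last first.
  by apply/funext => z; rewrite mulr1.
by rewrite (mean_scale mI) ?(mean_one mI) ?mulr1//; exact: bm_cst.
Qed.

Lemma mean_sum n (F : nat -> T -> R) : (forall i, bounded_measurable (F i)) ->
  I (fun z => \sum_(i < n) F i z) = \sum_(i < n) I (F i).
Proof.
move=> bF; elim: n => [|n IH].
  rewrite big_ord0 -[RHS]mean_cst; congr I.
  by apply/funext => z; rewrite big_ord0.
rewrite big_ord_recr/= -IH -(mean_add mI)//; last exact: bm_sum.
by congr I; apply/funext => z; rewrite big_ord_recr.
Qed.

Lemma mean_norm_le (g : T -> R) M : bounded_measurable g -> (forall z, `|g z| <= M) ->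
  `|I g| <= M.
Proof.
move=> bg gM; rewrite ler_norml; apply/andP; split.
  rewrite -[leLHS]mean_cst; apply: (mean_le mI) => //; first exact: bm_cst.
  by move=> z; have := gM z; rewrite ler_norml => /andP[].
rewrite -[leRHS]mean_cst; apply: (mean_le mI) => //; first exact: bm_cst.
by move=> z; have := gM z; rewrite ler_norml => /andP[].
Qed.

Lemma mean_01 (g : T -> R) : measurable_fun [set: T] g -> (forall z, 0 <= g z <= 1) ->
  0 <= I g <= 1.
Proof.
move=> mg g01; have bg := bm_unit mg g01; apply/andP; split.
  rewrite -[leLHS]mean_cst; apply: (mean_le mI) => //; first exact: bm_cst.
  by move=> z; have /andP[] := g01 z.
rewrite -[leRHS]mean_cst; apply: (mean_le mI) => //; first exact: bm_cst.
by move=> z; have /andP[] := g01 z.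
Qed.

End mean_functional.

Section indicators.
Context {d} {T : measurableType d} {R : realType}.

Lemma bm_indic (A : set T) : measurable A ->
  bounded_measurable (\1_A : T -> R).
Proof.
move=> mA; apply: bm_unit; first exact: measurable_indic.
by move=> z; rewrite indicE; case: (_ \in _); rewrite /= ?lexx ler01.
Qed.

Lemma mean_indic_le (I : (T -> R) -> R) (A B : set T) : mean_functional I ->
  measurable A -> measurable B -> A `<=` B -> I \1_A <= I \1_B.
Proof.
move=> mI mA mB AB; apply: (mean_le mI); [exact: bm_indic|exact: bm_indic|].
move=> z; rewrite !indicE ler_nat.
by have [/set_mem/AB/mem_set ->//|] := boolP (z \in A).
Qed.

Lemma mean_indicU (I : (T -> R) -> R) (A B : set T) : mean_functional I ->
  measurable A -> measurable B -> A `&` B = set0 ->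
  I \1_(A `|` B) = I \1_A + I \1_B.
Proof.
move=> mI mA mB AB0; rewrite -(mean_add mI); [|exact: bm_indic|exact: bm_indic].
congr I; apply/funext => z; rewrite !indicE in_setU.
have [zA|] := boolP (z \in A); have [zB|] := boolP (z \in B) => /=;
  rewrite ?addr0 ?add0r//.
have : (A `&` B) z by split; exact: set_mem.
by rewrite AB0.
Qed.

Lemma mean_indic_ge0 (I : (T -> R) -> R) (A : set T) : mean_functional I ->
  measurable A -> 0 <= I \1_A.
Proof.
move=> mI mA; rewrite -(mean_cst mI 0); apply: (mean_le mI).
- exact: bm_cst.
- exact: bm_indic.
- by move=> z; rewrite indicE.
Qed.

Lemma mean_indic0 (I : (T -> R) -> R) : mean_functional I -> I \1_set0 = 0.
Proof. by move=> mI; rewrite indic0 -[RHS](mean_cst mI). Qed.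

End indicators.

(** * Variation in the coordinate directions *)

Section directions.
Context {R : realType}.
Implicit Types (b : bool) (z : R * R).

Definition translate b (u : R) z : R * R :=
  if b then (z.1 + u, z.2) else (z.1, z.2 + u).

Definition coordinate b z : R := if b then z.1 else z.2.

Lemma measurable_translate b u : measurable_fun [set: R * R] (translate b u).
Proof.
case: b; apply/measurable_fun_pairP; split => /=.
- by apply: measurable_funD; [exact: measurable_fst|exact: measurable_cst].
- exact: measurable_snd.
- exact: measurable_fst.
- by apply: measurable_funD; [exact: measurable_snd|exact: measurable_cst].
Qed.

Lemma translateD b u v z : translate b u (translate b v z) = translate b (v + u) z.
Proof. by case: b; rewrite /translate/= addrA. Qed.

Lemma translate0 b z : translate b 0 z = z.
Proof. by case: b; case: z => x y; rewrite /translate/= addr0. Qed.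

(* [M] bounds the total variation in the direction [b] of the density
   representing [I]. *)
Definition directional_bv b (I : (R * R -> R) -> R) (M : R) :=
  forall g : R * R -> R, measurable_fun [set: R * R] g -> (forall z, 0 <= g z <= 1) ->
  forall u, 0 <= u -> I g <= I (g \o translate b u) + M * u.

Lemma directional_bvW b I M N : M <= N -> directional_bv b I M ->
  directional_bv b I N.
Proof.
move=> MN HI g mg g01 u u0; apply: (le_trans (HI g mg g01 u u0)).
by rewrite lerD2l ler_wpM2r.
Qed.

(** The interval is one-sided and closed: [[f - w, f]] contains every point that a shift by [w] to
    the right carries onto or across the threshold [f]. *)
Definition near_points (F : seq R) (w x : R) := has (fun f => f - w <= x <= f) F.

Lemma measurable_near_points F w (l : R * R -> R) :
  measurable_fun [set: R * R] l ->
  measurable_fun [set: R * R] (fun z => near_points F w (l z)).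
Proof.
move=> ml; elim: F => [|f F IH]; first exact: measurable_cst.
rewrite (_ : (fun _ => _) = fun z =>
  ((f - w <= l z) && (l z <= f)) || near_points F w (l z)) //.
apply: measurable_or => //; apply: measurable_and;
  by apply: measurable_fun_ler => //; exact: measurable_cst.
Qed.

(** This gap between distinct thresholds bounds how far strips at different thresholds can be moved
    before they meet. In the induction, [gap] compares the new head with the tail. *)
Lemma separated (F : seq R) : exists2 dl : R, 0 < dl &
  forall f f', f \in F -> f' \in F -> f < f' -> f + dl <= f'.
Proof.
have gap (x : R) (G : seq R) : exists2 e : R, 0 < e &
    forall y, y \in G -> (x < y -> x + e <= y) /\ (y < x -> y + e <= x).
  elim: G => [|y G [e e0 He]]; first by exists 1.
  exists (if x == y then e else Num.min e `|x - y|).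
    by case: eqVneq => // xy; rewrite lt_min e0 normr_gt0 subr_eq0.
  move=> v; rewrite inE => /orP[/eqP ->|vG].
    case: eqVneq => [->|xy]; first by rewrite !ltxx.
    have : Num.min e `|x - y| <= `|x - y| by rewrite ge_min lexx orbT.
    set m := Num.min _ _ => mm.
    split => h.
      by move: mm; rewrite ltr0_norm ?subr_lt0//; lra.
    by move: mm; rewrite gtr0_norm ?subr_gt0//; lra.
  have [h1 h2] := He v vG; case: eqVneq => // xy.
  have mm : Num.min e `|x - y| <= e by rewrite ge_min lexx.
  by split => [/h1|/h2]; lra.
elim: F => [|x F [e e0 He]]; first by exists 1.
have [e' e'0 He'] := gap x F.
exists (Num.min e e'); first by rewrite lt_min e0.
have m1 : Num.min e e' <= e by rewrite ge_min lexx.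
have m2 : Num.min e e' <= e' by rewrite ge_min lexx orbT.
move=> f f'; rewrite !inE => /orP[/eqP ->|fF] /orP[/eqP ->|f'F].
- by rewrite ltxx.
- by move=> /(He' _ f'F).1; lra.
- by move=> /(He' _ fF).2; lra.
- by move=> /(He _ _ fF f'F); lra.
Qed.

(* The strips [l^-1 [f - w, f]] and their translates by multiples of [2 w] are
   disjoint, so that the mass of the strips is at most [1 / m] plus the cost of
   a single translation by [2 w]. *)
Lemma strip_mass (F : seq R) : exists C : R,
  forall (b : bool) I M (l : R * R -> R), mean_functional I ->
  directional_bv b I M -> measurable_fun [set: R * R] l ->
  (forall u z, l (translate b u z) = l z + u) ->
  forall w, 0 < w ->
  I (fun z => (near_points F w (l z))%:R) <= (2 * M + C) * w.
Proof.
have [dl dl0 sepF] := separated F.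
(* If [m >= 1] translates fit in the gap, then [m + 1 <= 2 * m] gives [1 / m <= 4 * w / dl]. If none
   fits, then [dl < 2 * w] and the bound exceeds one. *)
exists (4 / dl) => b I M l mI HI ml lt w w0.
set B := fun z => (near_points F w (l z))%:R.
have w20 : 0 < 2 * w by lra.
have [mB B01] : measurable_fun [set: R * R] B /\ forall z, 0 <= B z <= 1.
  split; first by have [] := bm_bool (R := R) (measurable_near_points F w ml).
  by move=> z; rewrite /B; case: near_points; rewrite /= ?lexx ler01.
have bB := bm_unit mB B01.
pose Bk (k : nat) z := B (translate b (k%:R * (2 * w)) z).
have bBk k : bounded_measurable (Bk k).
  by apply: bm_comp bB => //; exact: measurable_translate.
have Bk0 : Bk 0%N = B by apply/funext => z; rewrite /Bk mul0r translate0.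
pose m := Num.truncn (dl / (2 * w)).
have dw0 : 0 <= dl / (2 * w) by rewrite divr_ge0// ltW.
have /andP[m_le m_gt] := truncn_itv dw0.
have m2w : m%:R * (2 * w) <= dl by rewrite -ler_pdivlMr.
have mS2w : dl < (m%:R + 1) * (2 * w).
  by rewrite -ltr_pdivrMr// natr1.
have near1 z : near_points F w (l z) -> exists2 f, f \in F & f - w <= l z <= f.
  by move=> /hasP[f fF ?]; exists f.
have Bkle1 j : (j <= m)%N -> forall z, 0 <= \sum_(i < j) Bk i z <= 1.
  move=> jm z; apply/andP; split.
    by apply: sumr_ge0 => i _; have /andP[] := B01 (translate b (i%:R * (2 * w)) z).
  elim: j jm => [|j IH] jm; first by rewrite big_ord0 ler01.
  rewrite big_ord_recr/=.
  have [/eqP Bj0|Bj0] := boolP (Bk j z == 0); first by rewrite Bj0 addr0 IH// ltnW.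
  rewrite big1 ?add0r; first by have /andP[] := B01 (translate b (j%:R * (2 * w)) z).
  (* Suppose the shifts [i < j] both hit strips, at [f] and [f']. The strips have width [w] and the
     shifts differ by at least [2 * w], so [f < f'] and hence [f + dl <= f']. But for [j < m] the
     shifts differ by at most [dl - 2 * w], which is too little. *)
  move=> i _; apply/eqP/negPn/negP => Bi0.
  have near k : Bk k z != 0 -> exists2 f, f \in F & f - w <= l z + k%:R * (2 * w) <= f.
    rewrite /Bk /B => h; have /near1[f fF] : near_points F w (l (translate b (k%:R * (2 * w)) z)).
      by apply/negPn/negP => /negbTE E; rewrite E eqxx in h.
    by rewrite lt; exists f.
  have [f fF /andP[f1 f2]] := near _ Bi0.
  have [f' f'F /andP[f1' f2']] := near _ Bj0.
  have ij : (i%:R + 1) * (2 * w) <= j%:R * (2 * w) :> R.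
    by rewrite ler_pM2r// natr1 ler_nat.
  have jm' : (j%:R + 1) * (2 * w) <= m%:R * (2 * w) :> R.
    by rewrite ler_pM2r// natr1 ler_nat.
  have i0 : 0 <= i%:R * (2 * w) :> R by rewrite mulr_ge0// ltW.
  have ff' : f < f' by lra.
  by have := sepF _ _ fF f'F ff'; lra.
(* Regularity is applied to the sum of the first [j] translates, which stays in [0, 1] by
   disjointness. Translating it by [2 * w] raises every index by one, so the two sums telescope and
   the cost is paid once, not [j] times. *)
have step j : (j <= m)%N -> I B <= I (Bk j) + M * (2 * w).
  move=> jm.
  have := HI (fun z => \sum_(i < j) Bk i z).
  have mg : measurable_fun [set: R * R] (fun z => \sum_(i < j) Bk i z).
    by have [] := bm_sum j bBk.
  move=> /(_ mg (Bkle1 j jm) (2 * w) (ltW w20)).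
  rewrite (_ : (fun z => _) \o _ = fun z => \sum_(i < j) Bk i.+1 z); last first.
    apply/funext => z /=; apply: eq_bigr => i _; rewrite /Bk translateD.
    by congr (B (translate _ _ _)); rewrite -natr1; ring.
  rewrite (mean_sum mI _ bBk).
  rewrite (mean_sum mI _ (F := fun i => Bk i.+1) (fun i => bBk i.+1)).
  have : \sum_(i < j.+1) I (Bk i) = I (Bk 0%N) + \sum_(i < j) I (Bk i.+1).
    by rewrite big_ord_recl.
  rewrite big_ord_recr/= Bk0 => e h.
  move: e h; move: (\sum_(i < j) I (Bk i)) (\sum_(i < j) I (Bk i.+1)).
  by move: (I B) (I (Bk j)) => x y x1 x2; clear; lra.
(* The masses of the [m] disjoint translates add up to at most one. *)
have sumle : m%:R * I B <= 1 + m%:R * (M * (2 * w)).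
  have : \sum_(i < m) I B <= \sum_(i < m) (I (Bk i) + M * (2 * w)).
    by apply: ler_sum => i _; apply: step; exact: ltnW.
  rewrite sumr_const big_split/= sumr_const card_ord.
  rewrite -[I B *+ m]mulr_natl -[_ * (2 * w) *+ m]mulr_natl => /le_trans; apply.
  rewrite lerD2r -(mean_sum mI)//.
  by have /andP[] := mean_01 mI (proj1 (bm_sum m bBk)) (Bkle1 m (leqnn m)).
have /andP[IB0 IB1] := mean_01 mI mB B01.
have M0 : 0 <= M.
  have := HI (fun=> 1) (@measurable_cst _ _ _ _ _ _).
  have l1 (z : R * R) : 0 <= (1 : R) <= 1 by rewrite ler01 lexx.
  move=> /(_ l1 1 ler01); rewrite (_ : _ \o _ = fun=> 1)//.
  by rewrite lerDl mulr1.
move: (I B) IB1 sumle => IB IB1 sumle.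
have Mw0 : 0 <= M * w by rewrite mulr_ge0// ltW.
suff : IB <= 2 * (M * w) + 4 * (w / dl) by lra.
have wdl : w = (w / dl) * dl by rewrite mulfVK// gt_eqF.
set x := w / dl in wdl *.
have [m0|m0] := posnP m.
  have : 1 < 2 * x by rewrite -(ltr_pM2r dl0); move: mS2w; rewrite m0; lra.
  lra.
have m1 : 1 <= m%:R :> R by rewrite ler1n.
have hx : 1 <= 4 * x * m%:R.
  rewrite -(ler_pM2r dl0); have : w * m%:R >= w by rewrite ler_peMr// ltW.
  by rewrite {1 2}wdl; nra.
have m0' : 0 < m%:R :> R by rewrite ltr0n.
by rewrite -(ler_pM2l m0'); lra.
Qed.

End directions.

(** * The averaged operator *)

Section markov_operator.
Context {R : realType}.
Variables (beta a c : R) (wt : bool -> bool -> bool -> nat -> R).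
Hypothesis beta1 : 1 < beta.
Hypothesis wt_ge0 : forall b1 b2 b3 i, 0 <= wt b1 b2 b3 i.
Hypothesis wt_sum : forall b1 b2 b3,
  wt b1 b2 b3 0 + wt b1 b2 b3 1 + wt b1 b2 b3 2 = 1.
Implicit Types (z : R * R) (g : R * R -> R) (b : bool).

(** The weight depends on [z] only through its position relative to three lines. On the triangle
    these three comparisons identify the piece of the partition that contains [z]. *)
Definition weight (i : nat) z :=
  wt (a <= z.1) (a <= z.2) (c < z.1 + z.2) i.

Definition markov g z : R :=
  weight 0 z * g (bmap beta 0 z) + weight 1 z * g (bmap beta 1 z)
  + weight 2 z * g (bmap beta 2 z).

Lemma markovE g z : markov g z = weight 0 z * g (bmap beta 0 z)
  + weight 1 z * g (bmap beta 1 z) + weight 2 z * g (bmap beta 2 z).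
Proof. by []. Qed.

Lemma markov_01 g : (forall z, 0 <= g z <= 1) ->
  forall z, 0 <= markov g z <= 1.
Proof.
move=> g01 z; rewrite /markov /weight.
move: (a <= z.1) (a <= z.2) (c < z.1 + z.2) => b1 b2 b3.
have h0 := wt_ge0 b1 b2 b3 0; have h1 := wt_ge0 b1 b2 b3 1.
have h2 := wt_ge0 b1 b2 b3 2; have := wt_sum b1 b2 b3; move: h0 h1 h2.
move: (g01 (bmap beta 0 z)) (g01 (bmap beta 1 z)) (g01 (bmap beta 2 z)).
move: (g _) (g _) (g _) (wt _ _ _ _) (wt _ _ _ _) (wt _ _ _ _).
move=> g0 g1 g2 w0 w1 w2 /andP[? ?] /andP[? ?] /andP[? ?] ? ? ? ?.
have ? : 0 <= w0 * (1 - g0) by apply: mulr_ge0; lra.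
have ? : 0 <= w1 * (1 - g1) by apply: mulr_ge0; lra.
have ? : 0 <= w2 * (1 - g2) by apply: mulr_ge0; lra.
apply/andP; split; last lra.
by rewrite !addr_ge0// mulr_ge0.
Qed.

Lemma measurable_weight i : measurable_fun [set: R * R] (weight i).
Proof.
have m1 : measurable_fun [set: R * R] (fun z => a <= z.1).
  by apply: measurable_fun_ler; [exact: measurable_cst|exact: measurable_fst].
have m2 : measurable_fun [set: R * R] (fun z => a <= z.2).
  by apply: measurable_fun_ler; [exact: measurable_cst|exact: measurable_snd].
have m3 : measurable_fun [set: R * R] (fun z => c < z.1 + z.2).
  apply: measurable_fun_ltr; first exact: measurable_cst.
  by apply: measurable_funD; [exact: measurable_fst|exact: measurable_snd].
rewrite (_ : weight i = fun z =>
  if a <= z.1 then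
    if a <= z.2 then
      if c < z.1 + z.2 then wt true true true i else wt true true false i
    else if c < z.1 + z.2 then wt true false true i else wt true false false i
  else if a <= z.2 then
      if c < z.1 + z.2 then wt false true true i else wt false true false i
    else if c < z.1 + z.2 then wt false false true i
         else wt false false false i); last first.
  by apply/funext => z; rewrite /weight; do 3 case: ifP.
by do 3 (apply: measurable_fun_ifT => //).
Qed.

Lemma bm_weight i : bounded_measurable (weight i).
Proof.
split; first exact: measurable_weight.
exists (`|wt true true true i| + `|wt true true false i|
  + `|wt true false true i| + `|wt true false false i|
  + `|wt false true true i| + `|wt false true false i|
  + `|wt false false true i| + `|wt false false false i|) => z.
have n := @normr_ge0 _ R.
rewrite /weight; case: (a <= z.1); case: (a <= z.2); case: (c < z.1 + z.2);
 have := n (wt true true true i); have := n (wt true true false i);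
 have := n (wt true false true i); have := n (wt true false false i);
 have := n (wt false true true i); have := n (wt false true false i);
 have := n (wt false false true i); have := n (wt false false false i); lra.
Qed.

Lemma measurable_bmap i : measurable_fun [set: R * R] (bmap beta i).
Proof.
apply/measurable_fun_pairP; split; rewrite /bmap /=.
  apply: measurable_funB; last exact: measurable_cst.
  by apply: measurable_funM; [exact: measurable_cst|exact: measurable_fst].
apply: measurable_funB; last exact: measurable_cst.
by apply: measurable_funM; [exact: measurable_cst|exact: measurable_snd].
Qed.

Lemma bm_markov g : bounded_measurable g -> bounded_measurable (markov g).
Proof.
move=> bg; rewrite /markov; apply: bm_add; first apply: bm_add.
all: by apply: bm_mul; [exact: bm_weight|exact: (bm_comp (measurable_bmap _) bg)].
Qed.

Lemma bm_iter_markov n g : bounded_measurable g ->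
  bounded_measurable (iter n markov g).
Proof. by move=> bg; elim: n => //= n; exact: bm_markov. Qed.

Lemma iter_markov_01 n g : (forall z, 0 <= g z <= 1) ->
  forall z, 0 <= iter n markov g z <= 1.
Proof. by move=> g01; elim: n => //= n; exact: markov_01. Qed.

Lemma mean_markov I : mean_functional I ->
  mean_functional (fun g => I (markov g)).
Proof.
move=> mI; split.
- move=> g h bg bh; rewrite -(mean_add mI); [|exact: bm_markov|exact: bm_markov].
  by congr I; apply/funext => z; rewrite /markov; ring.
- move=> k g bg; rewrite -(mean_scale mI); last exact: bm_markov.
  by congr I; apply/funext => z; rewrite /markov; ring.
- move=> g h bg bh gh; apply: (mean_le mI); [exact: bm_markov|exact: bm_markov|].
  by move=> z; rewrite /markov !lerD// ler_wpM2l// /weight wt_ge0.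
- rewrite -[RHS](mean_one mI); congr I.
  by apply/funext => z; rewrite /markov !mulr1 /weight wt_sum.
Qed.

Lemma mean_iter_markov n I : mean_functional I ->
  mean_functional (fun g => I (iter n markov g)).
Proof.
elim: n I => [|n IH] I mI //=.
by have := IH _ (mean_markov mI).
Qed.

(* The discontinuities of the n-step weights lie on finitely many lines
   parallel to the sides of the triangle. *)
Lemma iter_markov_translate n : exists F : seq R,
  forall b g z u, 0 <= u ->
  ~~ near_points F (u / beta ^+ n) (coordinate b z) ->
  ~~ near_points F (u / beta ^+ n) (z.1 + z.2) ->
  iter n markov (g \o translate b u) z
  = iter n markov g (translate b (u / beta ^+ n) z).
Proof.
have b0 : 0 < beta by exact: lt_trans beta1.
elim: n => [|n [F IH]].
  by exists [::] => b g z u _ _ _; rewrite expr0 divr1.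
(* The thresholds of one step are followed by the pullbacks of the earlier ones. Each [qvec] has its
   coordinates and their sum in {0, 1}, so for each of the forms [x], [y] and [x + y] a branch acts
   as multiplication by [beta] minus 0 or 1. One list thus serves all three forms. *)
exists (a :: c :: [seq x / beta | x <- F] ++ [seq (x + 1) / beta | x <- F]).
move=> b g z u u0; set w := u / beta ^+ n.+1.
have w0 : 0 <= w by rewrite divr_ge0// exprn_ge0// ltW.
have wE : u / beta ^+ n = beta * w.
  by rewrite /w exprS invfM; field; rewrite expf_neq0 gt_eqF.
have scaled (q : R) (x : R) : (q = 0) \/ (q = 1) ->
    near_points F (beta * w) (beta * x - q) ->
    near_points ([seq x / beta | x <- F] ++ [seq (x + 1) / beta | x <- F]) w x.
  move=> q01 /hasP[f fF /andP[f1 f2]].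
  have inF : (f + q) / beta \in
      [seq x / beta | x <- F] ++ [seq (x + 1) / beta | x <- F].
    rewrite mem_cat; case: q01 => ->; apply/orP.
      by left; rewrite addr0; apply/mapP; exists f.
    by right; apply/mapP; exists f.
  apply/hasP; exists ((f + q) / beta) => //; apply/andP; split.
    rewrite lerBlDr ler_pdivrMr//; lra.
  by rewrite ler_pdivlMr//; lra.
rewrite /near_points /= !negb_or => /and3P[na nc nF] /and3P[na' nc' nF'].
(* The translation moves one coordinate and the sum, and neither crosses its threshold. Closed
   strips cover both the weak comparison with [a] and the strict one with [c]. *)
have weightE i : weight i z = weight i (translate b w z).
  rewrite /weight.
  suff [-> -> ->] : [/\ (a <= (translate b w z).1) = (a <= z.1),
    (a <= (translate b w z).2) = (a <= z.2) &
    (c < (translate b w z).1 + (translate b w z).2) = (c < z.1 + z.2)] by [].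
  have keep x : ~~ (a - w <= x <= a) -> (a <= x + w) = (a <= x).
    move=> na0; apply/idP/idP; last by move=> ?; lra.
    move=> h; rewrite leNgt; apply/negP => xa.
    by move/negP: na0; apply; apply/andP; split; lra.
  have keepc x : ~~ (c - w <= x <= c) -> (c < x + w) = (c < x).
    move=> na0; apply/idP/idP; last by move=> ?; lra.
    move=> h; rewrite ltNge; apply/negP => xa.
    by move/negP: na0; apply; apply/andP; split; lra.
  rewrite /translate; clear nF; move: na nc na' nc'; case: b => /=.
    by move=> /keep -> _ _ /keepc <-; rewrite addrAC.
  by move=> /keep -> _ _ /keepc <-; rewrite addrA.
have stepE i : (i < 3)%N ->
  iter n markov (g \o translate b u) (bmap beta i z)
  = iter n markov g (bmap beta i (translate b w z)).
  move=> i3.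
  have q1 : ((qvec R i).1 = 0 \/ (qvec R i).1 = 1) /\
            ((qvec R i).2 = 0 \/ (qvec R i).2 = 1) /\
            ((qvec R i).1 + (qvec R i).2 = 0 \/
             (qvec R i).1 + (qvec R i).2 = 1).
    by case: i i3 => [|[|[|]]]//= _; rewrite ?addr0 ?add0r; tauto.
  rewrite IH //.
  - congr (iter n markov g _); rewrite wE /bmap /translate.
    by case: (b) => /=; congr (_, _); ring.
  - rewrite wE; apply: contra nF => nearF; apply: (@scaled
      (if b then (qvec R i).1 else (qvec R i).2)).
      by case: (b); tauto.
    by move: nearF; rewrite /coordinate; case: (b).
  - rewrite wE; apply: contra nF' => nF'.
    apply: (@scaled ((qvec R i).1 + (qvec R i).2)); first tauto.
    move: nF'; rewrite /bmap /=.
    by rewrite (_ : beta * z.1 - _ + _ = beta * (z.1 + z.2) -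
      ((qvec R i).1 + (qvec R i).2))//; ring.
by rewrite /= !markovE !stepE// !weightE.
Qed.

(** Put [w = u / beta ^+ n]. Off the strips, translating by [u] before the [n] steps amounts to
    translating by [w] after them, which costs [M * w]. On the strips all values lie in [0, 1], so
    the error is at most their mass, [(2 * M + C) * w] for each of the two directions of lines. The
    total is [(5 * M + 2 * C) * w]. *)
Lemma lasota_yorke n : exists C : R, forall b I M, mean_functional I ->
  directional_bv b I M ->
  directional_bv b (fun g => I (iter n markov g)) (5 / beta ^+ n * M + C).
Proof.
have b0 : 0 < beta by exact: lt_trans beta1.
have [F HF] := iter_markov_translate n.
have [C HC] := strip_mass F.
exists (2 * C / beta ^+ n) => b I M mI HI g mg g01 u u0.
have [->|] := eqVneq u 0.
  rewrite mulr0 addr0 (_ : g \o _ = g)//.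
  by apply/funext => z /=; rewrite translate0.
move=> un0; have {un0}u0' : 0 < u by rewrite lt_neqAle eq_sym un0.
set w := u / beta ^+ n.
have w0 : 0 < w by rewrite divr_gt0// exprn_gt0.
pose B1 z : R := (near_points F w (coordinate b z))%:R.
pose B2 z : R := (near_points F w (z.1 + z.2))%:R.
have mc : measurable_fun [set: R * R] (coordinate b).
  by case: (b); [exact: measurable_fst|exact: measurable_snd].
have ms : measurable_fun [set: R * R] (fun z : R * R => z.1 + z.2).
  by apply: measurable_funD; [exact: measurable_fst|exact: measurable_snd].
have IB1 : I B1 <= (2 * M + C) * w.
  by apply: (HC b) => //; case: (b).
have IB2 : I B2 <= (2 * M + C) * w.
  apply: (HC b _ _ (fun z => z.1 + z.2)) => //.
  by move=> v z; rewrite /translate; case: (b) => /=; rewrite ?addrA// addrAC.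
have bB1 : bounded_measurable B1 := bm_bool (measurable_near_points F w mc).
have bB2 : bounded_measurable B2 :=
  bm_bool (measurable_near_points F w ms).
have bg := bm_unit mg g01.
have bG := bm_iter_markov n bg.
have G01 := iter_markov_01 n g01.
have btg : bounded_measurable (g \o translate b u).
  exact: (bm_comp (measurable_translate b u) bg).
have bPtg := bm_iter_markov n btg.
have := HI _ (proj1 bG) G01 w (ltW w0).
have : I (iter n markov g \o translate b w) <=
    I (fun z => iter n markov (g \o translate b u) z + (B1 z + B2 z)).
  apply: (mean_le mI).
  - exact: (bm_comp (measurable_translate b w) bG).
  - exact/(bm_add bPtg)/bm_add.
  move=> z /=; rewrite /B1 /B2.
  have /andP[_ G1] := G01 (translate b w z).
  have tg01 v : 0 <= (g \o translate b u) v <= 1 by exact: g01.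
  have /andP[G0 _] := iter_markov_01 n tg01 z.
  have [n1|n1] := boolP (near_points F w (coordinate b z)).
    by case: near_points => /=; lra.
  have [n2|n2] := boolP (near_points F w (z.1 + z.2)); first by rewrite /=; lra.
  by rewrite HF//= !addr0.
rewrite (mean_add mI)//; last exact: bm_add.
rewrite (mean_add mI)//.
rewrite (_ : (_ + _) * u = (5 * M + 2 * C) * w); last by rewrite /w; ring.
move: (I B1) (I B2) IB1 IB2 (I (iter n markov (g \o _))) (I (_ \o _)).
by move: (I _) => x y1 y2; clear; move=> ? ? ? ? ? ?; lra.
Qed.

(** Once [beta ^+ N >= 10], a block of [N] steps at least halves the variation up to an additive
    constant. Strong induction by blocks of [N] then gives a bound uniform in the number of
    steps. *)
Lemma iter_directional_bv b I M : mean_functional I -> directional_bv b I M ->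
  exists N, forall k, directional_bv b (fun g => I (iter k markov g)) N.
Proof.
move=> mI HI.
have [N N0 betaN] : exists2 N, (0 < N)%N & 10 <= beta ^+ N.
  have b1 : 0 < beta - 1 by rewrite subr_gt0.
  pose N := (Num.truncn (10 / (beta - 1))).+1.
  exists N => //.
  have bb : 10 / (beta - 1) < N%:R.
    by have := @truncnS_gt R (10 / (beta - 1)).
  have : 10 < N%:R * (beta - 1) by rewrite -ltr_pdivrMr.
  (* Bernoulli's inequality. *)
  have bern k : 1 + k%:R * (beta - 1) <= beta ^+ k.
    elim: k => [|k IH]; first by rewrite mul0r addr0 expr0.
    rewrite exprS -natr1.
    have k0 : 0 <= k%:R :> R by [].
    have : 0 <= k%:R * (beta - 1) * (beta - 1) by rewrite !mulr_ge0//; lra.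
    have : beta * (1 + k%:R * (beta - 1)) <= beta * beta ^+ k.
      by rewrite ler_pM2l//; lra.
    lra.
  by have := bern N; lra.
have [C HC] := lasota_yorke N.
have one k : exists Mk, directional_bv b (fun g => I (iter k markov g)) Mk.
  have [Ck HCk] := lasota_yorke k.
  by exists (5 / beta ^+ k * M + Ck); exact: HCk.
have [Mf HMf] := choice one.
(* [Ms] dominates the bounds of the first [N] iterates, and [Ms / 2 + C <= Ms], so it is preserved
   by a block of [N] steps. *)
pose Ms := \sum_(i < N) `|Mf i| + 2 * `|C|.
have sum0 : 0 <= \sum_(i < N) `|Mf i| by apply: sumr_ge0.
have C0 : C <= `|C| := ler_norm C.
exists Ms; elim/ltn_ind => k IH.
have [kN|Nk] := ltnP k N.
  apply: directional_bvW (HMf k); apply: (le_trans (ler_norm _)).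
  rewrite /Ms (bigD1 (Ordinal kN))//= -addrA lerDl.
  by apply: addr_ge0; [exact: sumr_ge0|exact: mulr_ge0].
have kN : (k - N < k)%N by rewrite ltn_subrL N0 (leq_trans N0 Nk).
have := HC b _ Ms (mean_iter_markov (k - N) mI) (IH _ kN).
have -> : (fun g => I (iter (k - N) markov (iter N markov g))) =
          (fun g => I (iter k markov g)).
  by apply/funext => g; rewrite -iterD subnK.
apply: directional_bvW.
have Ms0 : 0 <= Ms by rewrite addr_ge0// mulr_ge0.
have bN : 5 / beta ^+ N <= 2^-1.
  by rewrite ler_pdivrMr ?exprn_gt0 ?(lt_trans _ beta1)//; lra.
have : 5 / beta ^+ N * Ms <= 2^-1 * Ms by rewrite ler_wpM2r.
have : 2 * `|C| <= Ms by rewrite lerDr.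
by move: (5 / _ * Ms) C0 => D; lra.
Qed.

End markov_operator.

(** * Expectations and planar Lebesgue measure *)

Section expectation_functional.
Context {d} {T : measurableType d} {R : realType} (P : probability T R).
Implicit Types g h : T -> R.

Definition expect g : R := (\int[P]_z g z)%R.

Lemma bm_integrable g : bounded_measurable g ->
  P.-integrable [set: T] (EFin \o g).
Proof.
move=> [mg [M gM]]; apply: measurable_bounded_integrable => //.
  by rewrite (le_lt_trans (probability_le1 P measurableT))// ltry.
exists M; split; first exact: num_real.
by move=> x Mx z _; rewrite /=; apply: (le_trans (gM z)); exact: ltW.
Qed.

Lemma mean_expect : mean_functional expect.
Proof.
split.
- by move=> g h bg bh; rewrite /expect RintegralD//; exact: bm_integrable.
- by move=> k g bg; rewrite /expect RintegralZl//; exact: bm_integrable.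
- by move=> g h bg bh gh; apply: le_Rintegral => //; exact: bm_integrable.
- by rewrite /expect Rintegral_cst// mul1r/= probability_setT.
Qed.

Lemma EFin_expect g : bounded_measurable g ->
  ((expect g)%:E = \int[P]_z (g z)%:E)%E.
Proof.
by move=> bg; rewrite /expect/Rintegral fineK// integrable_fin_num// bm_integrable.
Qed.

Lemma expect_indic (A : set T) : measurable A -> (expect \1_A)%:E = P A.
Proof.
move=> mA; rewrite EFin_expect; last exact: bm_indic.
by rewrite integral_indic// setIT.
Qed.

End expectation_functional.

(** Exchange of the order of integration is made a property of the functional, because the iterates
    of the operator are never presented as integrals against a measure. *)
Definition fubini_functional {d} {T : measurableType d} {R : realType}
    (I : (T -> R) -> R) :=
  forall d' (V : measurableType d') (Q : probability V R) (G : T * V -> R),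
  measurable_fun [set: T * V] G -> (forall x, 0 <= G x <= 1) ->
  measurable_fun [set: V] (fun v => I (fun z => G (z, v))) /\
  expect Q (fun v => I (fun z => G (z, v)))
  = I (fun z => expect Q (fun v => G (z, v))).

Section fubini.
Context {d} {T : measurableType d} {R : realType} (P : probability T R).

Lemma measurable_expect {d'} {V : measurableType d'} (Q : probability V R)
    (G : T * V -> R) :
  measurable_fun [set: T * V] G -> (forall x, 0 <= G x <= 1) ->
  measurable_fun [set: T] (fun z => expect Q (fun v => G (z, v))).
Proof.
move=> mG G01.
have mE : measurable_fun [set: T * V] (EFin \o G) by exact/measurable_EFinP.
have G0 x : (0 <= (EFin \o G) x)%E.
  by rewrite /= lee_fin; have /andP[] := G01 x.
apply: measurableT_comp => //.
exact: (measurable_fun_fubini_tonelli_F _ mE G0).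
Qed.

Lemma fubini_expect : fubini_functional (expect P).
Proof.
move=> d' V Q G mG G01.
have mE : measurable_fun [set: T * V] (EFin \o G) by exact/measurable_EFinP.
have G0 x : (0 <= (EFin \o G) x)%E.
  by rewrite /= lee_fin; have /andP[] := G01 x.
have m1 : measurable_fun [set: V] (fun v => expect P (fun z => G (z, v))).
  apply: measurableT_comp => //.
  exact: (measurable_fun_fubini_tonelli_G _ mE G0).
have m2 := measurable_expect Q mG G01.
have b1 z : bounded_measurable (fun v => G (z, v)).
  by apply: bm_unit => //; exact: measurableT_comp.
have b2 v : bounded_measurable (fun z => G (z, v)).
  by apply: bm_unit => //; exact: measurableT_comp.
split => //; apply: EFin_inj; rewrite !EFin_expect.
- under eq_integral do rewrite EFin_expect//.
  under [RHS]eq_integral do rewrite EFin_expect//.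
  exact/esym/(fubini_tonelli _ mE G0).
- apply: bm_unit => // z; apply: (mean_01 (mean_expect Q)) => //.
  exact: (proj1 (b1 z)).
- apply: bm_unit => // v; apply: (mean_01 (mean_expect P)) => //.
  exact: (proj1 (b2 v)).
Qed.

End fubini.

Section fubini_markov.
Context {R : realType}.
Variables (beta a c : R) (wt : bool -> bool -> bool -> nat -> R).
Hypothesis wt_ge0 : forall b1 b2 b3 i, 0 <= wt b1 b2 b3 i.
Hypothesis wt_sum : forall b1 b2 b3,
  wt b1 b2 b3 0 + wt b1 b2 b3 1 + wt b1 b2 b3 2 = 1.

(** The operator acts on the first variable by a finite combination whose weights do not involve the
    second, so it commutes with expectation in the second variable. The exchange for [I] is then
    applied to the image of [G]. *)
Lemma fubini_markov (I : (R * R -> R) -> R) : fubini_functional I ->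
  fubini_functional (fun g => I (markov beta a c wt g)).
Proof.
move=> FI d' V Q G mG G01.
pose G' (x : (R * R) * V) :=
  markov beta a c wt (fun z => G (z, x.2)) x.1.
have mG' : measurable_fun [set: (R * R) * V] G'.
  have mt i : measurable_fun [set: (R * R) * V]
      (fun x => weight a c wt i x.1 * G (bmap beta i x.1, x.2)).
    apply: measurable_funM.
      exact: (measurableT_comp (measurable_weight a c wt i)).
    apply: (measurableT_comp mG); apply/measurable_fun_pairP; split => /=.
      exact: (measurableT_comp (measurable_bmap beta i)).
    exact: measurable_snd.
  exact: (measurable_funD (measurable_funD (mt 0) (mt 1)) (mt 2)).
have G'01 x : 0 <= G' x <= 1 by apply: markov_01 => // z.
have [h1 h2] := FI _ _ Q G' mG' G'01; split; first exact: h1.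
rewrite [LHS]h2; congr I; apply/funext => z.
have bG y : bounded_measurable (fun v => G (y, v)).
  by apply: bm_unit => //; exact: measurableT_comp.
have mQ := mean_expect Q.
rewrite /G' /= /markov (mean_add mQ) ?(mean_add mQ) ?(mean_scale mQ)//.
all: by rewrite ?/bounded_measurable; repeat apply: bm_add; apply: bm_scale.
Qed.

Lemma fubini_iter_markov n (I : (R * R -> R) -> R) : fubini_functional I ->
  fubini_functional (fun g => I (iter n (markov beta a c wt) g)).
Proof.
elim: n I => [|n IH] I FI //=.
by have := IH _ (fubini_markov FI).
Qed.

End fubini_markov.

Section plane_lebesgue.
Context {R : realType}.
Local Notation leb := (@lebesgue_measure R).
Local Notation leb2 := (leb \x leb)%E.

Lemma lebesgue_measure_shift (u : R) (A : set R) : measurable A ->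
  leb ((fun x => x + u) @^-1` A) = leb A.
Proof.
pose f0 : measurableTypeR R -> measurableTypeR R := fun x => x + u.
have mf : measurable_fun [set: measurableTypeR R] f0.
  by apply: measurable_funD => //; exact: measurable_cst.
pose f : {mfun measurableTypeR R >-> measurableTypeR R} :=
  HB.pack f0 (isMeasurableFun.Build _ _ _ _ _ mf).
move=> mA; apply/esym.
apply: (@lebesgue_measure_unique R (pushforward leb f)) => // _ [[x y] _ <-] /=.
rewrite /pushforward.
have -> : f @^-1` `]x, y] = `]x - u, y - u]%classic.
  by apply/seteqP; split => z; rewrite /f/= /f0 !in_itv/= ltrBlDr lerBrDr.
rewrite !lebesgue_measure_itv/= !lte_fin ltrD2r.
by case: ifP => // _; rewrite -!EFinB; congr EFin; ring.
Qed.

(** By uniqueness of the product measure it suffices to check rectangles, of which only one side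
    moves. *)
Lemma leb2_translate b (u : R) (A : set (R * R)) : measurable A ->
  leb2 (translate b u @^-1` A) = leb2 A.
Proof.
pose f0 : (measurableTypeR R * measurableTypeR R)%type ->
  (measurableTypeR R * measurableTypeR R)%type := translate b u.
have mf : measurable_fun setT f0 := measurable_translate b u.
pose f : {mfun (measurableTypeR R * measurableTypeR R)%type >->
               (measurableTypeR R * measurableTypeR R)%type} :=
  HB.pack f0 (isMeasurableFun.Build _ _ _ _ _ mf).
move=> mA; apply/esym.
apply: (@product_measure_unique _ _ _ _ _ leb leb (pushforward leb2 f)) => //.
move=> B C mB mC; rewrite /pushforward.
have mshift (D : set (measurableTypeR R)) : measurable D ->
    measurable ((fun x => x + u) @^-1` D : set (measurableTypeR R)).
  move=> mD; rewrite -[X in measurable X]setTI.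
  by apply: measurable_funD => //; exact: measurable_cst.
rewrite [LHS](_ : _ = leb2 (f @^-1` (B `*` C)))//.
have -> : f @^-1` (B `*` C) =
    if b then ((fun x => x + u) @^-1` B) `*` C
    else B `*` ((fun x => x + u) @^-1` C).
  by rewrite /f/= /f0; case: (b).
case: (b); (rewrite product_measure1E//; last exact: mshift);
  by congr (_ * _)%E; exact: lebesgue_measure_shift.
Qed.

End plane_lebesgue.

(** * Layer-cake approximation by indicators *)

Section layers.
Context {d} {T : measurableType d} {R : realType}.
Implicit Types g : T -> R.

(** The sum is the integer part of [x]. *)
Lemma sum_layers (n : nat) (x : R) : 0 <= x <= n%:R ->
  x - 1 <= \sum_(k < n) (k.+1%:R <= x)%R%:R <= x.
Proof.
move=> /andP[x0 xn].
have [h1 h2] : (n%:R <= x -> \sum_(k < n) (k.+1%:R <= x)%R%:R = n%:R :> R) /\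
    (x <= n%:R -> x - 1 <= \sum_(k < n) (k.+1%:R <= x)%R%:R <= x).
  elim: n {xn} => [|n [IH1 IH2]].
    rewrite big_ord0; split => // ?; apply/andP; split; lra.
  rewrite big_ord_recr/= -natr1; split => h.
    by rewrite IH1 ?h//; lra.
  have [nx|nx] := leP n%:R x.
    rewrite IH1//; have [h'|h'] := leP (n%:R + 1) x.
      by rewrite /= -[1%:R]/(1 : R); apply/andP; split; lra.
    by rewrite addr0; apply/andP; split; lra.
  rewrite (_ : (n%:R + 1 <= x) = false); first by rewrite addr0 IH2// ltW.
  by apply/negbTE; rewrite -ltNge; lra.
exact: h2.
Qed.

Lemma measurable_layer g (x y : R) : measurable_fun [set: T] g ->
  measurable [set z | x <= y * g z].
Proof.
move=> mg; rewrite (_ : [set z | _] = setT `&` (fun z => x <= y * g z) @^-1` [set true]).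
  apply: measurable_fun_ler => //; apply: measurable_funM => //.
by rewrite setTI; apply/seteqP; split.
Qed.

(** Slicing [g] at the levels [k / n] gives a simple function between [g - 1 / n] and [g]. This
    carries statements from sets to functions by linearity and monotonicity alone, so it also
    applies to means that are not yet known to be countably additive. *)
Lemma mean_layers (I : (T -> R) -> R) g n : mean_functional I ->
  measurable_fun [set: T] g -> (forall z, 0 <= g z <= 1) -> (0 < n)%N ->
  `|I g - n%:R^-1 * \sum_(k < n) I \1_[set z | k.+1%:R <= n%:R * g z]|
  <= n%:R^-1.
Proof.
move=> mI mg g01 n0; have n0' : 0 < n%:R :> R by rewrite ltr0n.
pose A (k : nat) := [set z | k.+1%:R <= n%:R * g z].
have AE k z : \1_(A k) z = (k.+1%:R <= n%:R * g z)%R%:R :> R.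
  by rewrite indicE; congr (nat_of_bool _)%:R; apply/idP/idP; rewrite inE.
have bA k : bounded_measurable (\1_(A k) : T -> R).
  rewrite (_ : \1_(A k) = fun z => (k.+1%:R <= n%:R * g z)%R%:R); last first.
    exact/funext.
  apply: bm_bool; apply: measurable_fun_ler; first exact: measurable_cst.
  by apply: measurable_funM => //; exact: measurable_cst.
have bg := bm_unit mg g01.
rewrite -(mean_sum mI _ bA) -(mean_scale mI); last exact: (bm_sum n bA).
have bS := bm_scale (n%:R^-1 : R) (bm_sum n bA).
have est z : g z - n%:R^-1 <= n%:R^-1 * (\sum_(k < n) \1_(A k) z) <= g z.
  under eq_bigr do rewrite AE.
  have /andP[gz0 gz1] := g01 z.
  have : 0 <= n%:R * g z <= n%:R by rewrite mulr_ge0// ?ler_piMr// ltW.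
  move=> /sum_layers/andP[h1 h2].
  rewrite ler_pdivlMl// ler_pdivrMl// mulrBr mulfV ?gt_eqF//.
  by rewrite h1 h2.
have up : I (fun z => n%:R^-1 * \sum_(k < n) \1_(A k) z) <= I g.
  by apply: (mean_le mI) => // z; have /andP[] := est z.
have lo : I g <= I (fun z => n%:R^-1 * (\sum_(k < n) \1_(A k) z) + n%:R^-1).
  apply: (mean_le mI) => //; first by apply: bm_add => //; exact: bm_cst.
  by move=> z; have /andP[] := est z; rewrite lerBlDr.
move: lo; rewrite (mean_add mI)//; last exact: bm_cst.
rewrite (mean_cst mI) => lo.
by rewrite ger0_norm ?subr_ge0// lerBlDl.
Qed.

Lemma le_inv_nat (x : R) : (forall n, (0 < n)%N -> x <= n%:R^-1) -> x <= 0.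
Proof.
move=> h; rewrite leNgt; apply/negP => x0.
pose n := (Num.truncn x^-1).+1.
have nx : x^-1 < n%:R := truncnS_gt x^-1.
have := h n isT; rewrite leNgt => /negP; apply.
by rewrite invf_plt ?posrE.
Qed.

Lemma mean_functional_ext (I J : (T -> R) -> R) :
  mean_functional I -> mean_functional J ->
  (forall A, measurable A -> I \1_A = J \1_A) ->
  forall g, measurable_fun [set: T] g -> (forall z, 0 <= g z <= 1) -> I g = J g.
Proof.
move=> mI mJ IJ g mg g01; have mA n k : measurable [set z | k.+1%:R <= n%:R * g z].
  exact: measurable_layer.
apply/eqP; rewrite -subr_eq0 -normr_le0.
have : `|I g - J g| / 2 <= 0.
  apply: le_inv_nat => n n0.
  have := mean_layers mI mg g01 n0; have := mean_layers mJ mg g01 n0.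
  under eq_bigr do rewrite -IJ//.
  move: (n%:R^-1 * \sum_(k < n) _) => S; rewrite !ler_distl.
  move=> /andP[? ?] /andP[? ?].
  by rewrite ler_pdivrMr// ler_norml; apply/andP; split; lra.
by rewrite pmulr_lle0// invr_gt0.
Qed.

End layers.

(** * Uniform measures on squares, and smoothing by small translations *)

Section square.
Context {R : realType}.
Local Notation leb := (@lebesgue_measure R).
Local Notation leb2 := (leb \x leb)%E.

(** Each of the [n] level sets costs [M * u], and so does their average with weights [1 / n]; the
    slicing errors vanish as [n] grows. *)
Lemma bv_of_sets b (I : (R * R -> R) -> R) M : mean_functional I ->
  (forall A u, measurable A -> 0 <= u ->
    I \1_A <= I \1_(translate b u @^-1` A) + M * u) ->
  directional_bv b I M.
Proof.
move=> mI HI g mg g01 u u0.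
have mt := measurable_translate b u.
have mgt : measurable_fun [set: R * R] (g \o translate b u).
  exact: measurableT_comp.
rewrite -lerBlDr -subr_le0; set D := (X in X <= 0).
suff : D / 2 <= 0 by rewrite pmulr_lle0// invr_gt0.
apply: le_inv_nat => n n0.
have := mean_layers mI mg g01 n0.
have := mean_layers mI mgt (fun z => g01 (translate b u z)) n0.
have n0' : 0 < n%:R :> R by rewrite ltr0n.
have : n%:R^-1 * (\sum_(k < n) I \1_[set z | k.+1%:R <= n%:R * g z]) <=
  n%:R^-1 * (\sum_(k < n)
    I \1_[set z | k.+1%:R <= n%:R * (g \o translate b u) z]) + M * u.
  rewrite -(ler_pM2l n0') mulrDr !mulVKf ?gt_eqF//.
  apply: (le_trans (y := \sum_(k < n)
    (I \1_[set z | k.+1%:R <= n%:R * (g \o translate b u) z] + M * u))).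
    by apply: ler_sum => k _; apply: HI => //; exact: measurable_layer.
  by rewrite big_split/= sumr_const card_ord lerD2l -[_ *+ n]mulr_natl.
rewrite !ler_distl ler_pdivrMr// /D.
move: (n%:R^-1 * _) (n%:R^-1 * _) => S1 S2 ? /andP[? ?] /andP[? ?].
lra.
Qed.

Definition square (r : R) : set (R * R) := `[0, r] `*` `[0, r].

Lemma measurable_square r : measurable (square r).
Proof. by apply: measurableX; exact: measurable_itv. Qed.

(* [R] and [measurableTypeR R] carry the same measurable sets but different
   displays, so that the measure structure has to be transferred by hand. *)
Definition square_prob (r : R) (r0 : 0 < r) : set (R * R) -> \bar R :=
  (uniform_prob r0 \x uniform_prob r0)%E.

Section square_probability.
Variables (r : R) (r0 : 0 < r).

Let square_prob0 : square_prob r0 set0 = 0%E.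
Proof. exact: measure0. Qed.

Let square_prob_ge0 A : (0 <= square_prob r0 A)%E.
Proof. exact: measure_ge0. Qed.

Let square_prob_sigma_additive : semi_sigma_additive (square_prob r0).
Proof.
exact: (@measure_semi_sigma_additive _ _ _
  (uniform_prob r0 \x uniform_prob r0)%E).
Qed.

HB.instance Definition _ := isMeasure.Build _ (R * R)%type R (square_prob r0)
  square_prob0 square_prob_ge0 square_prob_sigma_additive.

Let square_prob_setT : square_prob r0 setT = 1%E.
Proof. exact: (probability_setT (uniform_prob r0 \x uniform_prob r0)%E). Qed.

HB.instance Definition _ := Measure_isProbability.Build _ _ _ (square_prob r0)
  square_prob_setT.

End square_probability.

Lemma uniform_prob0 (r : R) (r0 : 0 < r) (B : set R) : measurable B ->
  uniform_prob r0 B = ((r^-1)%:E * leb (B `&` `[0%R, r]))%E.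
Proof.
move=> mB; rewrite /uniform_prob integral_uniform_pdf.
rewrite (eq_integral (fun=> (r^-1)%:E)); last first.
  by move=> x; rewrite inE/= in_itv/= /uniform_pdf subr0 => -[_ ->].
by rewrite integral_cst//; exact: measurableI.
Qed.

Lemma square_probE r (r0 : 0 < r) A : measurable A ->
  square_prob r0 A = ((r ^- 2)%:E * leb2 (A `&` square r))%E.
Proof.
move=> mA; have k0 : 0 <= r ^- 2 by rewrite invr_ge0 exprn_ge0// ltW.
apply: (product_measure_unique
  (m' := mscale (NngNum k0) (mrestr leb2
     (measurable_square r : measurable
        (square r : set (measurableTypeR R * measurableTypeR R)%type))))) => //.
move=> B C mB mC.
transitivity ((r ^- 2)%:E * (leb (B `&` `[0%R, r]) * leb (C `&` `[0%R, r])))%E.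
  congr (_ * _)%E; rewrite -product_measure1E; [|exact: measurableI..].
  by congr (leb2 _); exact/esym/setXI.
transitivity (((r^-1)%:E * leb (B `&` `[0%R, r])) *
  ((r^-1)%:E * leb (C `&` `[0%R, r])))%E.
  by rewrite muleACA -EFinM -expr2 exprVn.
by congr (_ * _)%E; exact/esym/uniform_prob0.
Qed.

Lemma square_prob_le r (r0 : 0 < r) A : measurable A ->
  (square_prob r0 A <= (r ^- 2)%:E * leb2 A)%E.
Proof.
move=> mA; rewrite square_probE// lee_pmul2l//; last first.
  by rewrite lte_fin invr_gt0 exprn_gt0.
apply: le_measure; rewrite ?inE//; apply: measurableI => //.
exact: measurable_square.
Qed.

(** By translation invariance the mass of [A] in the square equals that of the translated set in the
    translated square. The latter leaves the unit square only inside the rectangle [E], whose area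
    is [u]. *)
Lemma square_bv b : directional_bv b (expect (square_prob ltr01)) 1.
Proof.
apply: bv_of_sets; first exact: mean_expect.
move=> A u mA u0; rewrite mul1r -lee_fin EFinD !expect_indic//; last first.
  rewrite -[X in measurable X]setTI; exact: measurable_translate.
rewrite /= !square_probE//; last first.
  rewrite -[X in measurable X]setTI; exact: measurable_translate.
rewrite expr1n invr1 !mul1e.
have mS := measurable_square 1.
have mt B : measurable B -> measurable (translate b u @^-1` B).
  move=> mB; rewrite -[X in measurable X]setTI; exact: measurable_translate.
rewrite -(@leb2_translate _ b u); last exact: measurableI.
pose E : set (R * R) := if b then `[- u, 0%R] `*` `[0%R, 1%R]
  else `[0%R, 1%R] `*` `[- u, 0%R].
have mE : measurable E by rewrite /E; case: (b); exact: measurableX.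
have EM : leb2 E = u%:E.
  have leb_itv (x y : R) : x <= y -> leb `[x, y] = (y - x)%:E.
    move=> xy; rewrite lebesgue_measure_itv/= lte_fin -EFinB.
    case: ltgtP xy => // -> _; by rewrite subrr.
  have leb0u : leb `[- u, 0%R] = u%:E by rewrite leb_itv ?oppr_le0// sub0r opprK.
  have leb01 : leb `[0%R, 1%R] = 1%E by rewrite leb_itv// subr0.
  rewrite /E; case: (b).
    transitivity (leb `[(- u)%R, 0%R] * leb `[0%R, 1%R])%E.
      exact: product_measure1E.
    by rewrite leb0u leb01 mule1.
  transitivity (leb `[0%R, 1%R] * leb `[(- u)%R, 0%R])%E.
    exact: product_measure1E.
  by rewrite leb0u leb01 mul1e.
apply: (@le_trans _ _ (leb2 ((translate b u @^-1` A `&` square 1) `|` E))).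
  apply: le_measure; rewrite ?inE; first by apply: mt; exact: measurableI.
    by apply: measurableU => //; apply: measurableI => //; exact: mt.
  move=> z [Az]; rewrite /E /square /translate /=.
  case: (b) Az => Az /=; rewrite !in_itv/= => -[/andP[z1 z2] /andP[z3 z4]].
    have [?|?] := leP 0 z.1; last by right; split; apply/andP; split; lra.
    by left; split => //; split; apply/andP; split; lra.
  have [?|?] := leP 0 z.2; last by right; split; apply/andP; split; lra.
  by left; split => //; split; apply/andP; split; lra.
rewrite -EM; apply: measureU2 => //; apply: measurableI => //; exact: mt.
Qed.

Lemma expect_le_square r (r0 : 0 < r) (g h : R * R -> R) :
  bounded_measurable g -> bounded_measurable h ->
  (forall z, square r z -> g z <= h z) ->
  expect (square_prob r0) g <= expect (square_prob r0) h.
Proof.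
move=> bg bh gh; have mI := mean_expect (square_prob r0).
have [_ [M gM]] := bg; have [_ [N hN]] := bh.
have mS := measurable_square r.
have bC : bounded_measurable (\1_(~` square r) : R * R -> R).
  by apply: bm_indic; exact: measurableC.
(* Adding [M + N] off the square, a null set, makes the comparison hold everywhere. *)
have : expect (square_prob r0) g <= expect (square_prob r0)
    (fun z => h z + (M + N) * \1_(~` square r) z).
  apply: (mean_le mI) => //; first by apply: bm_add => //; exact: bm_scale.
  move=> z; have [zS|zS] := pselect (square r z).
    by rewrite indicE memNset//= mulr0 addr0 gh.
  rewrite indicE mem_set//= mulr1.
  have := gM z; have := hN z; rewrite !ler_norml => /andP[? ?] /andP[? ?]; lra.
rewrite (mean_add mI)//; last exact: bm_scale.
rewrite (mean_scale mI)//.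
suff -> : expect (square_prob r0) \1_(~` square r) = 0 by rewrite mulr0 addr0.
apply: EFin_inj; rewrite expect_indic; last exact: measurableC.
rewrite /= square_probE; last exact: measurableC.
by rewrite setICl measure0 mule0.
Qed.

(** The indicator of [A] is averaged over translations by vectors of the square of side [r]. Each
    translation costs at most [M * r] per coordinate. By Fubini the averaged function at a point is
    the uniform mass of a translate of [A], which is at most the area of [A] divided by [r ^+ 2]. *)
Lemma density_bound (I : (R * R -> R) -> R) M r (A : set (R * R)) :
  mean_functional I -> fubini_functional I ->
  (forall b, directional_bv b I M) -> 0 < r -> measurable A ->
  ((I \1_A)%:E <= (r ^- 2)%:E * leb2 A + (2 * M * r)%:E)%E.
Proof.
move=> mI FI HI r0 mA.
have r20 : 0 < r ^- 2 by rewrite invr_gt0 exprn_gt0.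
have [Afin|] := boolP (leb2 A \is a fin_num); last first.
  rewrite ge0_fin_numE// -leNgt leye_eq => /eqP ->.
  by rewrite gt0_muley ?lte_fin// addye// leey.
have bA : bounded_measurable (\1_A : R * R -> R).
  exact: bm_indic.
have A01 z : 0 <= (\1_A z : R) <= 1.
  by rewrite indicE; case: (_ \in _); rewrite /= ?lexx ler01.
have M0 : 0 <= M.
  have := HI true (fun=> 1) (measurable_cst _) _ 1 ler01.
  rewrite (_ : _ \o _ = fun=> 1)// (mean_one mI) mulr1 lerDl; apply => z.
  by rewrite ler01 lexx.
pose s (x : (R * R) * (R * R)) := (x.1.1 + x.2.1, x.1.2 + x.2.2).
have ms : measurable_fun [set: (R * R) * (R * R)] s.
  apply/measurable_fun_pairP; split; apply: measurable_funD;
    by apply: measurableT_comp.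
have [m1 E1] := FI _ _ (square_prob r0) (\1_A \o s)
  (measurableT_comp (proj1 bA) ms) (fun x => A01 (s x)).
pose h (v : R * R) := I (fun z => (\1_A \o s) (z, v)).
have mQ := mean_expect (square_prob r0).
have lower : I \1_A - 2 * M * r <= expect (square_prob r0) h.
  rewrite -(mean_cst mQ (_ - _)); apply: expect_le_square.
  - exact: bm_cst.
  - apply: bm_unit => // v; apply: (mean_01 mI); last by move=> z; exact: A01.
    exact: (measurableT_comp (measurableT_comp (proj1 bA) ms)).
  move=> v [/=]; rewrite !in_itv/= => /andP[v10 v1r] /andP[v20 v2r].
  have h1 := HI true _ (proj1 bA) A01 v.1 v10.
  have := HI false _ (proj1 (bm_comp (measurable_translate true v.1) bA))
    (fun z => A01 (translate true v.1 z)) v.2 v20.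
  have -> : I ((\1_A \o translate true v.1) \o translate false v.2) = h v by [].
  have : M * v.1 <= M * r by rewrite ler_wpM2l.
  have : M * v.2 <= M * r by rewrite ler_wpM2l.
  rewrite lerBlDr; move: (h v) h1 => w; move: (I _) (I (_ \o _)) => x y; lra.
have upper : expect (square_prob r0) h <= r ^- 2 * fine (leb2 A).
  rewrite /h E1 -(mean_cst mI (_ * _)); apply: (mean_le mI).
  - apply: bm_unit; first exact: (measurable_expect (square_prob r0)
      (measurableT_comp (proj1 bA) ms) (fun x => A01 (s x))).
    move=> z; apply: (mean_01 mQ); last by move=> v; exact: A01.
    exact: (measurableT_comp (measurableT_comp (proj1 bA) ms)).
  - exact: bm_cst.
  move=> z; pose B := translate true z.1 @^-1` (translate false z.2 @^-1` A).
  have mt b u (D : set (R * R)) : measurable D ->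
      measurable (translate b u @^-1` D).
    move=> mD; rewrite -[X in measurable X]setTI; exact: measurable_translate.
  have mB : measurable B := mt _ _ _ (mt _ _ _ mA).
  rewrite (_ : (fun v => _) = \1_B); last first.
    apply/funext => v; rewrite /s/= !indicE; congr (nat_of_bool _)%:R.
    by apply/idP/idP; rewrite !inE /B /translate/= (addrC z.1) (addrC z.2).
  rewrite -lee_fin expect_indic// EFinM fineK//.
  apply: (le_trans (square_prob_le r0 mB)).
  by rewrite /B !leb2_translate//; exact: mt.
rewrite -(fineK Afin) -EFinM -EFinD lee_fin.
by move: lower upper; rewrite lerBlDr; lra.
Qed.

End square.

(** * Limits of Cesaro means *)

Section mean_measure.
Context {d} {T : measurableType d} {R : realType} (J : (T -> R) -> R).

Definition continuous_at_set0 := forall G : (set T)^nat,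
  (forall n, measurable (G n)) -> nonincreasing_seq G ->
  \bigcap_n G n = set0 -> J \1_(G n) @[n --> \oo] --> 0.

Hypotheses (mJ : mean_functional J) (cJ : continuous_at_set0).

(** The absolute value ensures nonnegativity on nonmeasurable sets, where [J] is unconstrained. The
    two proofs are arguments so that the measure structure can be attached to the term. *)
Definition mean_measure of mean_functional J & continuous_at_set0 :
  set T -> \bar R := fun A => `|J \1_A|%:E.

Local Notation mu := (mean_measure mJ cJ).

Lemma mean_measureE (A : set T) : measurable A -> mu A = (J \1_A)%:E.
Proof.
by move=> mA; rewrite /mean_measure ger0_norm// mean_indic_ge0.
Qed.

Let mean_measure0 : mu set0 = 0%E.
Proof. by rewrite mean_measureE// mean_indic0. Qed.

Let mean_measure_ge0 A : (0 <= mu A)%E.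
Proof. by rewrite /mean_measure lee_fin. Qed.

(** Disjointness makes the tails [G n] of the union decrease to the empty set. By finite additivity
    a partial sum is the total mass minus the mass of a tail, which tends to 0. *)
Let mean_measure_sigma_additive : semi_sigma_additive mu.
Proof.
move=> F mF tF mUF.
pose G (n : nat) := \bigcup_(i in [set i | (n <= i)%N]) F i.
have mG n : measurable (G n) by apply: bigcup_measurable => i _; exact: mF.
have GS n : G n = F n `|` G n.+1.
  apply/seteqP; split => [z [i /= ni Fi]|z [Fn|[i /= ni Fi]]].
  - move: ni; rewrite leq_eqVlt => /predU1P[->|ni]; first by left.
    by right; exists i.
  - by exists n => /=.
  - by exists i => //=; exact: ltnW.
have FG n : F n `&` G n.+1 = set0.
  apply/seteqP; split => // z [Fn [i /= ni Fi]].
  have := tF n i I I => /(_ (ex_intro _ z (conj Fn Fi))) ni'.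
  by rewrite ni' ltnn in ni.
have GU : \bigcup_n F n = G 0%N.
  by apply/seteqP; split => z [i _ Fi]; exists i.
have sumE n : J \1_(G 0%N) = \sum_(0 <= i < n) J \1_(F i) + J \1_(G n).
  elim: n => [|n IH]; first by rewrite big_geq// add0r.
  by rewrite big_nat_recr//= IH GS mean_indicU// addrA.
have -> : (fun n => \sum_(0 <= i < n) mu (F i))%E =
    (fun n => (J \1_(G 0%N) - J \1_(G n))%:E).
  apply/funext => n; rewrite (sumE n) addrK -sumEFin.
  by apply: eq_bigr => i _; rewrite mean_measureE.
rewrite GU mean_measureE//; apply: cvg_EFin; first exact: nearW.
rewrite -[X in _ --> X]subr0; apply: cvgB; first exact: cvg_cst.
apply: cJ => //.
- move=> m n mn; apply/subsetPset => z [i /= ni Fi]; exists i => //=.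
  exact: leq_trans ni.
- apply/seteqP; split => // z Gz; have [i _ Fi] := Gz 0%N I.
  have [j /= ij Fj] := Gz i.+1 I.
  have := tF i j I I => /(_ (ex_intro _ z (conj Fi Fj))) ij'.
  by rewrite ij' ltnn in ij.
Qed.

HB.instance Definition _ := isMeasure.Build _ _ _ (mean_measure mJ cJ)
  mean_measure0 mean_measure_ge0 mean_measure_sigma_additive.

Let mean_measure_setT : mu setT = 1%E.
Proof. by rewrite mean_measureE// indicT (mean_one mJ). Qed.

HB.instance Definition _ := Measure_isProbability.Build _ _ _
  (mean_measure mJ cJ) mean_measure_setT.

Lemma expect_mean_measure (P : probability T R) (g : T -> R) :
  (forall A, measurable A -> P A = (J \1_A)%:E) ->
  measurable_fun [set: T] g -> (forall z, 0 <= g z <= 1) -> expect P g = J g.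
Proof.
move=> PJ; apply: mean_functional_ext => //; first exact: mean_expect.
by move=> A mA; apply: EFin_inj; rewrite expect_indic// PJ.
Qed.

End mean_measure.

Lemma mean_functional_probability {d} {T : measurableType d} {R : realType}
    (J : (T -> R) -> R) : mean_functional J -> continuous_at_set0 J ->
  exists P : probability T R, forall A, measurable A -> P A = (J \1_A)%:E.
Proof.
by move=> mJ cJ; exists (mean_measure mJ cJ) => A mA; exact: mean_measureE.
Qed.

Section cesaro_limit.
Context {d} {T : measurableType d} {R : realType}.

(** The image ultrafilter has a cluster point in a compact segment, and a cluster point of an
    ultrafilter is a limit. *)
Lemma bounded_ultra_cvg (U : set_system nat) (u : nat -> R) (M : R) :
  UltraFilter U -> (forall n, `|u n| <= M) -> cvg (u @ U).
Proof.
move=> UU uM.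
have UP : ProperFilter U := ultra_proper.
have uUM : (u @ U) `[- M, M]%classic.
  by apply: (@filterS _ U _ setT) filterT => n _ /=; rewrite in_itv/= -ler_norml.
have [p [_ clp]] := @segment_compact R (- M) M (u @ U) _ uUM.
apply/cvg_ex; exists p => B Bp; rewrite /nbhs/=.
have [//|UnB] := in_ultra_setVsetC (u @^-1` B) UU.
have [x [nBx Bx]] := clp (~` B) B UnB Bp.
by have := nBx Bx.
Qed.

(** One ultrafilter gives limits for all bounded measurable functions at once, and such limits keep
    linearity and order. No subsequence has to be extracted. *)
Lemma cesaro_limit (I : nat -> (T -> R) -> R) (P : (T -> R) -> T -> R) :
  (forall n, mean_functional (I n)) ->
  (forall g, bounded_measurable g -> bounded_measurable (P g)) ->
  (forall n g, I n.+1 g = I n (P g)) ->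
  exists J, [/\ mean_functional J,
    forall g, bounded_measurable g -> J (P g) = J g &
    forall g C, bounded_measurable g -> (forall n, I n g <= C) -> J g <= C].
Proof.
move=> mI bP IS.
have [U [UU oU]] := @ultraFilterLemma nat \oo _.
have UP : ProperFilter U := ultra_proper.
pose A g n := n.+1%:R^-1 * \sum_(k < n.+1) I k g.
have n0 n : 0 < n.+1%:R :> R by rewrite ltr0n.
have cst_sum n (C : R) : n.+1%:R^-1 * \sum_(k < n.+1) C = C.
  by rewrite sumr_const card_ord -[C *+ _]mulr_natl mulKf// gt_eqF.
have A_add n g h : bounded_measurable g -> bounded_measurable h ->
    A (fun z => g z + h z) n = A g n + A h n.
  move=> bg bh; rewrite /A -mulrDr -big_split/=; congr (_ * _).
  by apply: eq_bigr => k _; exact: (mean_add (mI k)).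
have A_scale n k g : bounded_measurable g ->
    A (fun z => k * g z) n = k * A g n.
  move=> bg; rewrite /A [RHS]mulrCA; congr (_ * _); rewrite mulr_sumr.
  by apply: eq_bigr => i _; exact: (mean_scale (mI i)).
have A_le n g C : (forall k, I k g <= C) -> A g n <= C.
  move=> IC; rewrite -[leRHS](cst_sum n) /A ler_pM2l ?invr_gt0//.
  by apply: ler_sum => k _; exact: IC.
have A_mono n g h : bounded_measurable g -> bounded_measurable h ->
    (forall z, g z <= h z) -> A g n <= A h n.
  move=> bg bh gh; rewrite /A ler_pM2l ?invr_gt0//.
  by apply: ler_sum => k _; exact: (mean_le (mI k)).
have A_one n : A (fun=> 1) n = 1.
  by rewrite /A; under eq_bigr do rewrite (mean_one (mI _)); exact: cst_sum.
pose J g : R := lim (A g @ U).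
have AJ g : bounded_measurable g -> A g @ U --> J g.
  move=> bg; have [_ [M gM]] := bg.
  have IM k : `|I k g| <= M by exact: mean_norm_le.
  apply: (bounded_ultra_cvg (M := M)) => n; rewrite /A normrM.
  rewrite ger0_norm ?invr_ge0// -[leRHS](cst_sum n) ler_pM2l ?invr_gt0//.
  by apply: (le_trans (ler_norm_sum _ _ _)); exact: ler_sum.
exists J; split; first split.
- move=> g h bg bh.
  apply: (@cvg_unique _ _ (A (fun z => g z + h z) @ U)) => //=.
    by apply: AJ; exact: bm_add.
  rewrite (_ : A _ = A g \+ A h); last by apply/funext => n; exact: A_add.
  by apply: cvgD; exact: AJ.
- move=> k g bg.
  apply: (@cvg_unique _ _ (A (fun z => k * g z) @ U)) => //=.
    by apply: AJ; exact: bm_scale.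
  rewrite (_ : A _ = fun n => k * A g n); last first.
    by apply/funext => n; exact: A_scale.
  by apply: cvgMl_tmp; exact: AJ.
- move=> g h bg bh gh; apply: (ler_cvg_to (AJ g bg) (AJ h bh)).
  by apply: nearW => n; exact: A_mono.
- rewrite /J (_ : A _ = fun=> 1); last by apply/funext => n; exact: A_one.
  by apply: cvg_lim => //; exact: cvg_cst.
- move=> g bg.
  apply: (@cvg_unique _ _ (A (P g) @ U)) => //=; first by apply: AJ; exact: bP.
  (* The means of [P g] and [g] differ by a telescoping sum, of which two bounded terms divided by
     [n + 1] remain. The ultrafilter refines [\oo], so an ordinary limit suffices. *)
  rewrite (_ : A (P g) = A g \+ (fun n => n.+1%:R^-1 * (I n.+1 g - I 0%N g))).
    rewrite -[X in _ --> X]addr0; apply: cvgD; first exact: AJ.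
    have [_ [M gM]] := bg.
    apply: cvg_trans (cvg_app _ oU) _.
    apply/cvgrPdist_le => e e0; near=> n.
    have M0 : 0 <= M by apply: le_trans (gM point).
    have IM k : `|I k g| <= M by exact: mean_norm_le.
    rewrite sub0r normrN normrM ger0_norm ?invr_ge0// ler_pdivrMl//.
    apply: (le_trans (ler_normB _ _)).
    apply: (le_trans (lerD (IM _) (IM _))).
    rewrite -ler_pdivrMr//.
    apply: (@le_trans _ _ n%:R); last by rewrite ler_nat.
    by near: n; exact: nbhs_infty_ger.
  apply/funext => n /=; rewrite /A -mulrDr; congr (_ * _).
  under eq_bigr do rewrite -IS.
  have e1 : \sum_(k < n.+2) I k g = I 0%N g + \sum_(k < n.+1) I k.+1 g.
    by rewrite big_ord_recl.
  by move: e1; rewrite big_ord_recr/= addrA => ->; rewrite addrAC subrr add0r.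
- move=> g C bg IC; apply: (cvgr_to_le (AJ g bg)).
  by apply: nearW => n; exact: A_le.
Unshelve. all: by end_near.
Qed.

End cesaro_limit.

(** * An absolutely continuous stationary measure *)

Section stationary.
Context {R : realType}.
Variables (beta a c : R) (wt : bool -> bool -> bool -> nat -> R).
Hypothesis beta1 : 1 < beta.
Hypothesis wt_ge0 : forall b1 b2 b3 i, 0 <= wt b1 b2 b3 i.
Hypothesis wt_sum : forall b1 b2 b3,
  wt b1 b2 b3 0 + wt b1 b2 b3 1 + wt b1 b2 b3 2 = 1.
Local Notation leb2 := (@lebesgue_measure R \x @lebesgue_measure R)%E.
Local Notation markov := (markov beta a c wt).
Variable S : set (R * R).
Hypothesis mS : measurable S.
Hypothesis S_fin : (leb2 S < +oo)%E.
Hypothesis square_S : square 1 `<=` S.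
Hypothesis S_invariant : forall i z, (i < 3)%N -> S z ->
  weight a c wt i z != 0 -> S (bmap beta i z).

Let I0 := expect (square_prob (@ltr01 R)).

(** The point is that [M] is chosen before the number of steps [k]. *)
Lemma orbit_density_bound : exists M : R, 0 <= M /\
  forall k r A, 0 < r -> measurable A ->
  ((I0 (iter k markov \1_A))%:E <= (r ^- 2)%:E * leb2 A + (2 * M * r)%:E)%E.
Proof.
have mI0 : mean_functional I0 := mean_expect _.
have [N1 H1] := iter_directional_bv a c beta1 wt_ge0 wt_sum mI0 (square_bv true).
have [N2 H2] := iter_directional_bv a c beta1 wt_ge0 wt_sum mI0 (square_bv false).
exists (`|N1| + `|N2|); split; first by rewrite addr_ge0.
move=> k r A r0 mA.
apply: (density_bound (I := fun g => I0 (iter k markov g))) => //.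
- exact: mean_iter_markov.
- exact: (fubini_iter_markov beta a c wt_ge0 wt_sum k (fubini_expect _)).
- case; [apply: directional_bvW (H1 k)|apply: directional_bvW (H2 k)].
    by apply: (le_trans (ler_norm _)); rewrite lerDl.
  by apply: (le_trans (ler_norm _)); rewrite lerDr.
Qed.

Lemma iter_markov_supp k z : S z -> iter k markov \1_(~` S) z = 0.
Proof.
elim: k z => [|k IH] z Sz /=; first by rewrite indicE memNset//= => /(_ Sz).
have term i : (i < 3)%N ->
    weight a c wt i z * iter k markov \1_(~` S) (bmap beta i z) = 0.
  move=> i3; have [->|wi] := eqVneq (weight a c wt i z) 0; first by rewrite mul0r.
  by rewrite IH ?mulr0//; exact: S_invariant.
by rewrite markovE !term// !addr0.
Qed.

(** The density bound survives in the limit with a free parameter [r]. Taking [r] small first, and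
    then the area small, yields both continuity at the empty set, hence countable additivity, and
    absolute continuity. *)
Theorem stationary_measure : exists mu : probability (R * R)%type R,
  [/\ mu S = 1%E,
    forall A, measurable A -> leb2 (A `&` S) = 0%E -> mu A = 0%E &
    forall g : R * R -> R, measurable_fun [set: R * R] g ->
      (forall z, 0 <= g z <= 1) ->
      expect mu (markov g) = expect mu g].
Proof.
have [M [M0 HM]] := orbit_density_bound.
have mI0 : mean_functional I0 := mean_expect _.
have mSC : measurable (~` S) by exact: measurableC.
have [J [mJ JP Jle]] := cesaro_limit
  (fun k => mean_iter_markov beta a c wt_ge0 wt_sum k mI0)
  (fun g => @bm_markov R beta a c wt g)
  (fun n g => congr1 I0 (iterSr n markov g)).
(* The initial mass sits on the unit square, inside [S], and no branch of nonzero weight leaves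
   [S]. *)
have JSC : J \1_(~` S) = 0.
  apply/eqP; rewrite eq_le mean_indic_ge0// andbT.
  apply: Jle => [|k]; first exact: bm_indic.
  rewrite -(mean_cst mI0 0); apply: expect_le_square.
  - by apply: bm_iter_markov; exact: bm_indic.
  - exact: bm_cst.
  - by move=> z /square_S Sz; rewrite iter_markov_supp.
have Jbound A r : measurable A -> 0 < r ->
    J \1_A <= r ^- 2 * fine (leb2 (A `&` S)) + 2 * M * r.
  move=> mA r0.
  have mAS : measurable (A `&` S) by exact: measurableI.
  have mASC : measurable (A `&` ~` S) by exact: measurableI.
  have ASfin : leb2 (A `&` S) \is a fin_num.
    rewrite ge0_fin_numE//; apply: le_lt_trans S_fin.
    by apply: le_measure; rewrite ?inE//; exact: subIsetr.
  have -> : J \1_A = J \1_(A `&` S) + J \1_(A `&` ~` S).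
    rewrite -mean_indicU//; first by rewrite -setIUr setUv setIT.
    by rewrite setIACA setICr setI0.
  have h : J \1_(A `&` ~` S) <= 0.
    by rewrite -JSC; apply: mean_indic_le => //; exact: subIsetr.
  have : J \1_(A `&` S) <= r ^- 2 * fine (leb2 (A `&` S)) + 2 * M * r.
    apply: Jle => [|k]; first exact: bm_indic.
    by have := HM k r _ r0 mAS; rewrite -(fineK ASfin) -EFinM -EFinD lee_fin.
  by move: h; move: (J _) (J _) => x y; lra.
have cJ : continuous_at_set0 J.
  move=> G mG dG G0.
  have mGS n : measurable (G n `&` S) by exact: measurableI.
  have leb0 : leb2 (G n `&` S) @[n --> \oo] --> 0%E.
    have E0 : \bigcap_n (G n `&` S) = set0.
      by rewrite -subset0 -G0 => z Gz n _; have [] := Gz n I.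
    rewrite -(measure0 leb2) -E0; apply: nonincreasing_cvg_mu.
    - apply: le_lt_trans S_fin; apply: le_measure; rewrite ?inE//.
      exact: mGS.
    - exact: mGS.
    - by rewrite E0.
    - move=> m n mn; apply/subsetPset => z [Gz Sz]; split => //.
      by move/subsetPset: (dG _ _ mn); exact.
  have fine0 : fine (leb2 (G n `&` S)) @[n --> \oo] --> 0.
    exact: (fine_cvg leb0).
  apply/cvgrPdist_le => e e0.
  (* Chosen so that [2 * M * r <= e / 2]; [M + 1] keeps the denominator positive when [M] is 0. *)
  pose r := e / (4 * (M + 1)).
  have r0 : 0 < r by rewrite divr_gt0// mulr_gt0// ltr_wpDl.
  near=> n.
  rewrite sub0r normrN ger0_norm ?mean_indic_ge0//.
  apply: (le_trans (Jbound _ _ (mG n) r0)).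
  have h1 : 2 * M * r <= e / 2.
    rewrite /r mulrA ler_pdivrMr ?mulr_gt0// ?ltr_wpDl//; nra.
  have h2 : r ^- 2 * fine (leb2 (G n `&` S)) <= e / 2.
    rewrite ler_pdivrMl ?exprn_gt0//.
    near: n; apply: (cvgr_le _ fine0).
    by apply: mulr_gt0; [exact: exprn_gt0|exact: divr_gt0].
  lra.
have [mu muE] := mean_functional_probability mJ cJ.
exists mu; split.
- have : J \1_S + J \1_(~` S) = 1.
    rewrite -mean_indicU//; last exact: setICr.
    by rewrite setUv indicT (mean_one mJ).
  by rewrite JSC addr0 muE// => ->.
- move=> A mA A0; rewrite muE//; congr EFin; apply/eqP.
  rewrite eq_le mean_indic_ge0// andbT leNgt; apply/negP => JA0.
  (* The same choice with the mass of [A] as the tolerance: since [A] has no area in [S], its mass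
     would be at most half of itself. *)
  pose r := J \1_A / (4 * (M + 1)).
  have r0 : 0 < r by rewrite divr_gt0// mulr_gt0// ltr_wpDl.
  have := Jbound A r mA r0; rewrite A0 /= mulr0 add0r.
  have h1 : 2 * M * r <= J \1_A / 2.
    rewrite /r mulrA ler_pdivrMr ?mulr_gt0// ?ltr_wpDl//.
    by move: (J _) JA0 => x x0; nra.
  by move: (J _) JA0 h1 => x; lra.
- move=> g mg g01.
  rewrite !(expect_mean_measure mJ muE)//.
  + by apply: JP; exact: bm_unit.
  + by have [] := bm_markov beta a c wt (bm_unit mg g01).
  + exact: markov_01.
Unshelve. all: by end_near.
Qed.

End stationary.

(** * Bernoulli shifts and invariance *)

Section bernoulli_shift.
Context {R : realType} {k : nat}.

Lemma measurable_coord (i : nat) (a : 'I_k.+1) :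
  measurable [set w : Seqs k | w i = a].
Proof. by apply: sub_sigma_algebra; exists i, a. Qed.

Lemma measurable_coord_pred (P : pred 'I_k.+1) (i : nat) :
  measurable_fun [set: Seqs k] (fun w : Seqs k => P (w i)).
Proof.
apply: (measurable_fun_bool true); rewrite setTI.
rewrite (_ : _ @^-1` _ = \bigcup_(a in [set a | P a])
    [set w : Seqs k | w i = a]); last first.
  by apply/seteqP; split => [w Pw|w [a /= Pa ->]//]; exists (w i).
apply: fin_bigcup_measurable => [|a _]; first exact: finite_finset.
exact: measurable_coord.
Qed.

Lemma measurable_shift : measurable_fun [set: Seqs k] (@Defs.shift k).
Proof.
apply: (@measurability _ _ (Seqs k) (Seqs k) setT (@Defs.shift k)
  (@coord_sets k) erefl).
move=> _ [_ [i [a ->]] <-]; rewrite setTI.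
exact: (measurable_coord i.+1 a).
Qed.

Lemma cyl_measurable n (a : 'I_n -> 'I_k.+1) : measurable (cyl a).
Proof.
rewrite (_ : cyl a = \bigcap_(i in [set: 'I_n]) [set w : Seqs k | w i = a i]).
  apply: fin_bigcap_measurable; first exact: finite_finset.
  by move=> i _; exact: measurable_coord.
by apply/seteqP; split => w /= h i => [_|]; exact: h.
Qed.

(** The empty set is adjoined because two cylinders with incompatible prefixes are disjoint; this
    makes the family closed under intersection. *)
Definition cylinders : set (set (Seqs k)) :=
  [set A | A = set0 \/ exists n (a : 'I_n -> 'I_k.+1), A = cyl a].

Lemma cylinders_setI : setI_closed cylinders.
Proof.
have main n m (a : 'I_n -> 'I_k.+1) (b : 'I_m -> 'I_k.+1) : (n <= m)%N ->
    cylinders (cyl a `&` cyl b).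
  move=> nm; have [h|h] := pselect (forall i, b (widen_ord nm i) = a i).
    right; exists m, b; apply/seteqP; split => [w [_ //]|w wb]; split => // i.
    by rewrite -h -wb.
  left; apply/seteqP; split => // w [wa wb]; apply: h => i.
  by rewrite -wa -wb.
move=> A B [->|[n [a ->]]]; first by rewrite set0I; left.
move=> [->|[m [b ->]]]; first by rewrite setI0; left.
have [nm|/ltnW mn] := leqP n m; first exact: main.
by rewrite setIC; exact: main.
Qed.

(** A condition on coordinate [i] is a finite union of cylinders, over the words of length [i + 1]
    that end in the prescribed letter. *)
Lemma measurable_cylindersE : @measurable _ (Seqs k) = <<s cylinders >>.
Proof.
apply/seteqP; split.
  apply: smallest_sub; first exact: smallest_sigma_algebra.
  move=> _ [i [a ->]].
  rewrite (_ : [set w | _] = \bigcup_(f in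
      [set f : {ffun 'I_i.+1 -> 'I_k.+1} | f ord_max = a]) cyl f).
    apply: (@fin_bigcup_measurable _ (g_sigma_algebraType cylinders)).
      exact: finite_finset.
    by move=> f _; apply: sub_sigma_algebra; right; exists i.+1, f.
  apply/seteqP; split => [w /= wi|w [f /= fa /(_ ord_max) /= ->//]].
  exists [ffun j : 'I_i.+1 => w j]; first by rewrite /= ffunE.
  by move=> j; rewrite ffunE.
apply: smallest_sub; first exact: sigma_algebra_measurable.
move=> _ [->|[n [a ->]]]; first exact: measurable0.
exact: cyl_measurable.
Qed.

Variables (wt : 'I_k.+1 -> R) (m : probability (Seqs k) R).
Hypotheses (wt_ge0 : forall c, 0 <= wt c) (hm : is_product_measure wt m).

(** The first letter is independent of the shifted sequence. Both sides are finite measures in [B],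
    so cylinders suffice, and there prefixing the word with [c], as [a'] does, adds the single
    factor [wt c]. *)
Lemma product_measure_first c (B : set (Seqs k)) : measurable B ->
  m ([set w | w 0%N = c] `&` @Defs.shift k @^-1` B) = ((wt c)%:E * m B)%E.
Proof.
pose f : {mfun (Seqs k) >-> (Seqs k)} :=
  HB.pack (@Defs.shift k) (isMeasurableFun.Build _ _ _ _ _ measurable_shift).
pose m' := pushforward (mrestr m (measurable_coord 0 c)) f.
suff E A : measurable A -> m' A = mscale (NngNum (wt_ge0 c)) m A.
  by move=> mB; rewrite setIC; exact: (E B mB).
apply: (measure_unique cylinders (fun _ => setT)) => //.
- exact: measurable_cylindersE.
- exact: cylinders_setI.
(* The cylinder over the empty word is the whole space. *)
- move=> i; right; exists 0%N, (fun=> ord0).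
  by apply/seteqP; split => // w _ [].
- by apply/seteqP; split => // w _; exists 0%N.
- move=> _ [->|[n [a ->]]]; first by rewrite !measure0.
  pose a' (i : 'I_n.+1) := oapp a c (unlift ord0 i).
  transitivity ((wt c)%:E * (\prod_(i < n) wt (a i))%:E)%E; last first.
    by rewrite -(hm a).
  rewrite -EFinM; transitivity (m (cyl a')).
    congr (m _); apply/seteqP; split => [w [/= wa w0] i|w wa'].
      rewrite /a'; case: unliftP => [j ->|->] //=.
      by rewrite -wa.
    split => [i /=|].
      by have := wa' (lift ord0 i); rewrite /a' liftK.
    by have := wa' ord0; rewrite /a' unlift_none.
  rewrite hm big_ord_recl /a' unlift_none /=.
  by under eq_bigr do rewrite liftK.
- move=> _ /=; rewrite /m' /pushforward /mrestr.
  apply: (le_lt_trans (y := 1%E)); last exact: ltry.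
  apply: probability_le1; apply: measurableI; last exact: measurable_coord.
  by rewrite preimage_setT.
Qed.

(** The condition on the shifted sequence may depend on the letter just read, which is the form
    taken by preimages under [K_beta] where a coin is tossed. *)
Lemma product_measure_split (B : 'I_k.+1 -> set (Seqs k)) :
  (forall c, measurable (B c)) ->
  m [set w | B (w 0%N) (@Defs.shift k w)] = (\sum_(c < k.+1) (wt c)%:E * m (B c))%E.
Proof.
move=> mB.
pose F (c : 'I_k.+1) := [set w : Seqs k | w 0%N = c] `&` @Defs.shift k @^-1` (B c).
have mF c : measurable (F c).
  apply: measurableI; first exact: measurable_coord.
  by rewrite -[X in measurable X]setTI; exact: measurable_shift.
transitivity (m (\big[setU/set0]_(c < k.+1) F c)).
  congr (m _); apply/seteqP; split => w.
    move=> /= Bw; rewrite -bigcup_seq; exists (w 0%N) => //=.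
    by rewrite mem_index_enum.
  by rewrite -bigcup_seq => -[c _ [/= <-]].
rewrite measure_bigsetU_ord//; last first.
  by move=> i j _ _ [w [[/= <- _] [/= <- _]]].
by apply: eq_bigr => c _; exact: product_measure_first.
Qed.

End bernoulli_shift.

(** * Sections of product measures *)

Section product_sections.
Context {R : realType} {k1 k2 : nat}.
Variables (m1 : probability (Seqs k1) R) (m2 : probability (Seqs k2) R).

Lemma product_measure_swap {d1 d2} {T1 : measurableType d1}
    {T2 : measurableType d2} (P1 : probability T1 R) (P2 : probability T2 R)
    (A : set (T1 * T2)) : measurable A ->
  ((P1 \x P2) A = \int[P2]_y (P1 (ysection A y)))%E.
Proof.
move=> mA; rewrite (product_measure_unique (m' := (P1 \x^ P2)%E))//.
by move=> B C mB mC; exact: product_measure2E.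
Qed.

Lemma product_measure_le1 {d1 d2} {T1 : measurableType d1}
    {T2 : measurableType d2} (P1 : probability T1 R) (P2 : probability T2 R)
    (A : set (T1 * T2)) : measurable A -> ((P1 \x P2) A <= 1)%E.
Proof. by move=> mA; exact: (probability_le1 (P1 \x P2)%E mA). Qed.

Lemma product_measure_fin_num {d1 d2} {T1 : measurableType d1}
    {T2 : measurableType d2} (P1 : probability T1 R) (P2 : probability T2 R)
    (A : set (T1 * T2)) : measurable A -> (P1 \x P2)%E A \is a fin_num.
Proof.
move=> mA; rewrite ge0_fin_numE//.
by rewrite (le_lt_trans (product_measure_le1 P1 P2 mA))// ltry.
Qed.

(** The order of integration is exchanged so that the sequence being shifted is in the inner
    integral; the split by its first letter is then applied for each fixed second sequence. *)
Lemma product_split1 (wt : 'I_k1.+1 -> R)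
    (A : 'I_k1.+1 -> set (Seqs k1 * Seqs k2)) :
  (forall c, 0 <= wt c) -> is_product_measure wt m1 ->
  (forall c, measurable (A c)) ->
  ((m1 \x m2) [set x | A (x.1 0%N) (Defs.shift x.1, x.2)]
  = \sum_(c < k1.+1) (wt c)%:E * (m1 \x m2) (A c))%E.
Proof.
move=> wt0 h1 mA.
have mf : measurable_fun [set: Seqs k1 * Seqs k2]
    (fun x : Seqs k1 * Seqs k2 => (Defs.shift x.1, x.2)).
  apply/measurable_fun_pairP; split; last exact: measurable_snd.
  exact: (measurableT_comp (@measurable_shift k1) measurable_fst).
have mS : measurable
    [set x : Seqs k1 * Seqs k2 | A (x.1 0%N) (Defs.shift x.1, x.2)].
  rewrite (_ : [set x | _] = \bigcup_(c in [set: 'I_k1.+1])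
     ((fst @^-1` [set w : Seqs k1 | w 0%N = c]) `&`
      (fun x : Seqs k1 * Seqs k2 => (Defs.shift x.1, x.2)) @^-1` (A c))).
    apply: fin_bigcup_measurable => [|c _]; first exact: finite_finset.
    apply: measurableI; rewrite -[X in measurable X]setTI; last exact: mf.
    by apply: measurable_fst => //; exact: measurable_coord.
  apply/seteqP; split => [x /= Ax|x [c _ [/= <-]]//].
  by exists (x.1 0%N).
rewrite product_measure_swap//.
transitivity (\sum_(c < k1.+1)
    \int[m2]_u ((wt c)%:E * m1 (ysection (A c) u)))%E; last first.
  apply: eq_bigr => c _; rewrite (product_measure_swap m1 m2 (mA c)).
  rewrite ge0_integralZl_EFin//; exact: measurable_fun_ysection.
rewrite -ge0_integral_sum//.
- apply: eq_integral => u _.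
  rewrite -(product_measure_split wt0 h1 (B := fun c => ysection (A c) u)).
    by congr (m1 _); apply/seteqP; split => w; rewrite !ysectionE.
  by move=> c; exact: measurable_ysection.
- move=> c; apply: emeasurable_funM => //; exact: measurable_fun_ysection.
- by move=> c u _; rewrite mule_ge0// lee_fin.
Qed.

Lemma product_split2 (wt : 'I_k2.+1 -> R)
    (A : 'I_k2.+1 -> set (Seqs k1 * Seqs k2)) :
  (forall c, 0 <= wt c) -> is_product_measure wt m2 ->
  (forall c, measurable (A c)) ->
  ((m1 \x m2) [set x | A (x.2 0%N) (x.1, Defs.shift x.2)]
  = \sum_(c < k2.+1) (wt c)%:E * (m1 \x m2) (A c))%E.
Proof.
move=> wt0 h2 mA.
transitivity (\sum_(c < k2.+1)
    \int[m1]_w ((wt c)%:E * m2 (xsection (A c) w)))%E; last first.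
  apply: eq_bigr => c _; rewrite ge0_integralZl_EFin//.
  exact: measurable_fun_xsection.
rewrite -ge0_integral_sum//.
- apply: eq_integral => w _ /=.
  rewrite -(product_measure_split wt0 h2 (B := fun c => xsection (A c) w)).
    by congr (m2 _); apply/seteqP; split => u; rewrite !xsectionE.
  by move=> c; exact: measurable_xsection.
- move=> c; apply: emeasurable_funM => //; exact: measurable_fun_xsection.
- by move=> c u _; rewrite mule_ge0// lee_fin.
Qed.

End product_sections.

(** * The operator associated with [K_beta] *)

Section averaged_K_beta.
Context {R : realType}.
Variables (p s t beta : R).
Hypotheses (hp0 : 0 < p) (hp1 : p < 1) (hs : 0 < s) (ht : 0 < t).
Hypothesis (hst : s + t < 1).
Hypotheses (hb1 : 1 < beta) (hb2 : beta < 3 / 2).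
Local Notation leb2 := (@lebesgue_measure R \x @lebesgue_measure R)%E.

Let a := beta^-1.
Let c := (beta * (beta - 1))^-1.
Let e := (beta - 1)^-1.

(** The rows correspond, in order, to the pieces [C012], [C12], [C01], [E1], [C02], [E2] and [E0];
    entry [i] is the probability of the branch with digit [i]. *)
Definition branch_weight (b1 b2 b3 : bool) (i : nat) : R :=
  nth 0 (match b1, b2, b3 with
  | true, true, false => [:: s; t; 1 - s - t]
  | true, true, true => [:: 0; p; 1 - p]
  | true, false, false => [:: p; 1 - p; 0]
  | true, false, true => [:: 0; 1; 0]
  | false, true, false => [:: p; 0; 1 - p]
  | false, true, true => [:: 0; 0; 1]
  | false, false, _ => [:: 1; 0; 0]
  end) i.

Lemma branch_weight_ge0 b1 b2 b3 i : 0 <= branch_weight b1 b2 b3 i.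
Proof.
move: hp0 hp1 hs ht hst => ? ? ? ? ?.
by case: b1 b2 b3 i => -[] [] [|[|[|i]]] /=; rewrite /branch_weight/= ?nth_nil//;
  lra.
Qed.

Lemma branch_weight_sum b1 b2 b3 : branch_weight b1 b2 b3 0
  + branch_weight b1 b2 b3 1 + branch_weight b1 b2 b3 2 = 1.
Proof. by case: b1 b2 b3 => -[] []; rewrite /branch_weight/=; lra. Qed.

Let b0 : 0 < beta. Proof. by rewrite (lt_trans _ hb1). Qed.
Let bB : 0 < beta - 1. Proof. by rewrite subr_gt0. Qed.
Let ba : beta * a = 1. Proof. by rewrite /a mulfV// gt_eqF. Qed.
Let bc : beta * c = e.
Proof. by rewrite /c /e invfM mulrA mulfV ?mul1r// gt_eqF. Qed.
Let e1 : e * (beta - 1) = 1. Proof. by rewrite /e mulVf// gt_eqF. Qed.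
(** The assumption [beta < 3 / 2] enters here. The inequality puts the unit square inside the
    triangle and, divided by [beta], gives [2 * a < c], so that the square [E0] lies below the line
    [x + y = c]. *)
Let e_gt2 : 2 < e.
Proof. by rewrite -(ltr_pM2r bB) e1; move: hb2 => ?; lra. Qed.
Let eE : e = c + a.
Proof.
apply: (mulfI (lt0r_neq0 b0)); rewrite mulrDr ba bc; move: e1; lra.
Qed.
Let ac : 2 * a < c.
Proof. by rewrite -(ltr_pM2l b0) mulrCA ba bc mulr1. Qed.

Lemma measurable_S_beta : measurable (S_beta beta).
Proof.
have m1 : measurable_fun [set: R * R] fst := measurable_fst.
have m2 : measurable_fun [set: R * R] snd := measurable_snd.
have mb : measurable_fun [set: R * R]
    (fun z => [&& 0 <= z.1, 0 <= z.2 & z.1 + z.2 <= (beta - 1)^-1]).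
  apply: measurable_and; first exact: measurable_fun_ler.
  apply: measurable_and; first exact: measurable_fun_ler.
  by apply: measurable_fun_ler => //; exact: measurable_funD.
rewrite (_ : S_beta beta = setT `&`
  (fun z => [&& 0 <= z.1, 0 <= z.2 & z.1 + z.2 <= (beta - 1)^-1]) @^-1` [set true]).
  exact: mb.
rewrite setTI; apply/seteqP; split => z /=.
  by move=> [-> [-> ->]].
by move=> /and3P[].
Qed.

Lemma S_beta_finite : (leb2 (S_beta beta) < +oo)%E.
Proof.
have mS := measurable_S_beta; have mQ := measurable_square e.
apply: (@le_lt_trans _ _ (leb2 (square e))).
  apply: le_measure; rewrite ?inE// => z [z1 [z2 z3]].
  rewrite /square; split; rewrite /= in_itv/= -/e in z3 *; apply/andP; split; lra.
rewrite /square product_measure1E//.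
by rewrite /= !lebesgue_measure_itv/= lte_fin; case: ifP => _;
  rewrite -?EFinB -?EFinM ?mule0 ltry.
Qed.

Lemma square_sub_S_beta : square 1 `<=` S_beta beta.
Proof.
move=> z [/=]; rewrite !in_itv/= => /andP[z1 z1'] /andP[z2 z2'].
by move: e_gt2 => ?; do 2 split => //; rewrite -/e; lra.
Qed.

(** A branch that subtracts 1 from a coordinate has nonzero weight only where that coordinate is at
    least [a], and then the sum stays below [beta * e - 1 = e]. The branch that subtracts nothing
    has nonzero weight only where the sum is at most [c = e / beta]. *)
Lemma S_beta_invariant i z : (i < 3)%N -> S_beta beta z ->
  weight a c branch_weight i z != 0 -> S_beta beta (bmap beta i z).
Proof.
move: eE ac => eE' ac' i3 [z1 [z2 z3]]; rewrite -/e in z3.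
have be x : x <= e -> beta * x - 1 <= e.
  move=> xe; have : beta * x <= beta * e by rewrite ler_pM2l.
  by move: e1; lra.
have bx x : 0 <= x -> 0 <= beta * x by move=> ?; rewrite mulr_ge0// ltW.
have bax x : a <= x -> 0 <= beta * x - 1.
  by move=> ax; rewrite subr_ge0 -ba ler_pM2l.
have bcx x : x <= c -> beta * x <= e by move=> xc; rewrite -bc ler_pM2l.
have := be _ z3; have := bx _ z1; have := bx _ z2.
have := bcx (z.1 + z.2); have := bax z.1; have := bax z.2.
rewrite /weight /branch_weight /S_beta /bmap /= -/e mulrDr.
case: i i3 => [|[|[|i]]]// _; rewrite /qvec/=;
  case: (leP a z.1) => h1; case: (leP a z.2) => h2; case: (ltP c (z.1 + z.2)) => h3;
  rewrite /= ?eqxx// => ha1 ha2 hc hy hx hs3 _; (split; [|split]);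
  try (have ? := ha1 isT); try (have ? := ha2 isT); try (have ? := hc isT); lra.
Qed.

(** The inequalities that bound the triangle hold for [z], so the cascade of seven tests reduces to
    the three comparisons used by [weight]. *)
Lemma K_beta_branch z : S_beta beta z -> forall w u,
  K_beta beta ((w, u), z) =
  match a <= z.1, a <= z.2, c < z.1 + z.2 with
  | false, false, _ => ((w, u), bmap beta 0 z)
  | true, false, true => ((w, u), bmap beta 1 z)
  | false, true, true => ((w, u), bmap beta 2 z)
  | true, false, false => ((Defs.shift w, u),
      bmap beta (if nat_of_ord (w 0%N) == 0%N then 0 else 1) z)
  | true, true, true => ((Defs.shift w, u),
      bmap beta (if nat_of_ord (w 0%N) == 0%N then 1 else 2) z)
  | false, true, false => ((Defs.shift w, u),
      bmap beta (if nat_of_ord (w 0%N) == 0%N then 0 else 2) z)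
  | true, true, false => ((w, Defs.shift u), bmap beta (nat_of_ord (u 0%N)) z)
  end.
Proof.
move=> [z1 [z2 z3]] w u.
rewrite /K_beta /inE0 /inE1 /inE2 /inC01 /inC12 /inC02 /inC012.
rewrite z1 z2 z3 -/a -/c !andbT /= !ltNge -/a.
by case: (a <= z.1); case: (a <= z.2); case: (z.1 + z.2 <= c).
Qed.

Section invariance.
Variables (m1 : probability Omega R) (m2 : probability Upsilon R).
Hypothesis hm1 : is_product_measure (wt1 p) m1.
Hypothesis hm2 : is_product_measure (wt2 s t) m2.
Local Notation m12 := (m1 \x m2)%E.

Let wt1_ge0 i : 0 <= wt1 p i.
Proof. by move: hp0 hp1 => ? ?; rewrite /wt1; case: ifP => _; lra. Qed.

Let wt2_ge0 i : 0 <= wt2 s t i.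
Proof.
by move: hs ht hst => ? ? ?; rewrite /wt2; case: ifP => _; [lra|case: ifP => _; lra].
Qed.

(** This links the skew product to the operator. On each piece at most one sequence is read and
    shifted, and its first letter is independent of the rest, so the sections of [A] at the images
    of [z] are averaged with exactly the branch weights. *)
Lemma K_beta_section z (A : set ((Omega * Upsilon) * (R * R))) :
  S_beta beta z -> measurable A ->
  m12 (ysection (K_beta beta @^-1` A) z) =
  (markov beta a c branch_weight (fun y => fine (m12 (ysection A y))) z)%:E.
Proof.
move=> Sz mA; pose Ai i := ysection A (bmap beta i z).
have mAi i : measurable (Ai i) by exact: measurable_ysection.
have fAi i : (fine (m12 (Ai i)))%:E = m12 (Ai i).
  by rewrite fineK//; exact: product_measure_fin_num.
have combinationE (w0 w1 w2 : R) :
    ((w0 * fine (m12 (Ai 0%N)) + w1 * fine (m12 (Ai 1%N))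
      + w2 * fine (m12 (Ai 2%N)))%:E
    = w0%:E * m12 (Ai 0%N) + w1%:E * m12 (Ai 1%N) + w2%:E * m12 (Ai 2%N))%E.
  by rewrite !EFinD !EFinM !fAi.
have C1 i j : m12 [set x | A ((Defs.shift x.1, x.2),
      bmap beta (if nat_of_ord (x.1 0%N) == 0%N then i else j) z)] =
    (p%:E * m12 (Ai i) + (1 - p)%:E * m12 (Ai j))%E.
  have := product_split1 m2
    (A := fun k : 'I_2 => Ai (if nat_of_ord k == 0%N then i else j)) wt1_ge0 hm1 (fun k => mAi _).
  rewrite !big_ord_recl big_ord0 adde0 /= => <-.
  by congr (m12 _); apply/seteqP; split => x /=; rewrite /Ai ysectionE.
have C2 : m12 [set x | A ((x.1, Defs.shift x.2),
      bmap beta (nat_of_ord (x.2 0%N)) z)] =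
    (s%:E * m12 (Ai 0%N) + t%:E * m12 (Ai 1%N) + (1 - s - t)%:E * m12 (Ai 2%N))%E.
  have := product_split2 m1 (A := fun k : 'I_3 => Ai (nat_of_ord k)) wt2_ge0 hm2 (fun k => mAi _).
  rewrite !big_ord_recl big_ord0 adde0 /= addeA => <-.
  by congr (m12 _); apply/seteqP; split => x /=; rewrite /Ai ysectionE.
have det i : m12 [set x | A (x, bmap beta i z)] = m12 (Ai i).
  by rewrite /Ai ysectionE.
have -> : ysection (K_beta beta @^-1` A) z =
    [set x | A (K_beta beta ((x.1, x.2), z))].
  by rewrite ysectionE; apply/seteqP; split => -[].
under eq_set => x do rewrite (K_beta_branch Sz).
rewrite /markov /weight combinationE.
case: (a <= z.1); case: (a <= z.2); case: (c < z.1 + z.2);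
  rewrite /branch_weight/= ?C1 ?C2 ?mul0e ?mul1e ?adde0 ?add0e//.
all: by rewrite -det; congr (m12 _); apply/seteqP; split => -[].
Qed.

Lemma measurable_K_beta : measurable_fun setT (K_beta beta).
Proof.
have m1' : measurable_fun [set: (Omega * Upsilon) * (R * R)]
    (fun x => x.2.1) by exact: (measurableT_comp measurable_fst measurable_snd).
have m2' : measurable_fun [set: (Omega * Upsilon) * (R * R)]
    (fun x => x.2.2) by exact: (measurableT_comp measurable_snd measurable_snd).
have m3' : measurable_fun [set: (Omega * Upsilon) * (R * R)]
    (fun x => x.2.1 + x.2.2) by exact: measurable_funD.
have mw : measurable_fun [set: (Omega * Upsilon) * (R * R)]
    (fun x => x.1.1).
  exact: (measurableT_comp measurable_fst measurable_fst).
have mu' : measurable_fun [set: (Omega * Upsilon) * (R * R)]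
    (fun x => x.1.2).
  exact: (measurableT_comp measurable_snd measurable_fst).
have mb i : measurable_fun [set: (Omega * Upsilon) * (R * R)]
    (fun x => bmap beta i x.2).
  exact: (measurableT_comp (measurable_bmap beta i) measurable_snd).
have msw : measurable_fun [set: (Omega * Upsilon) * (R * R)]
    (fun x => (Defs.shift x.1.1, x.1.2)).
  apply/measurable_fun_pairP; split; last exact: mu'.
  exact: (measurableT_comp (@measurable_shift 1) mw).
have msu : measurable_fun [set: (Omega * Upsilon) * (R * R)]
    (fun x => (x.1.1, Defs.shift x.1.2)).
  apply/measurable_fun_pairP; split; first exact: mw.
  exact: (measurableT_comp (@measurable_shift 2) mu').
have mw0 i : measurable_fun [set: (Omega * Upsilon) * (R * R)]
    (fun x => nat_of_ord (x.1.1 0%N) == i).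
  exact: (measurableT_comp
    (@measurable_coord_pred 1 (fun k => nat_of_ord k == i) 0%N) mw).
have mu0 i : measurable_fun [set: (Omega * Upsilon) * (R * R)]
    (fun x => nat_of_ord (x.1.2 0%N) == i).
  exact: (measurableT_comp
    (@measurable_coord_pred 2 (fun k => nat_of_ord k == i) 0%N) mu').
pose br i j (x : (Omega * Upsilon) * (R * R)) :=
  if nat_of_ord (x.1.1 0%N) == 0%N then bmap beta i x.2 else bmap beta j x.2.
pose br3 (x : (Omega * Upsilon) * (R * R)) :=
  if nat_of_ord (x.1.2 0%N) == 0%N then bmap beta 0 x.2
  else if nat_of_ord (x.1.2 0%N) == 1%N then bmap beta 1 x.2
  else bmap beta 2 x.2.
have mbr i j : measurable_fun setT (br i j) by exact: measurable_fun_ifT.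
have mbr3 : measurable_fun setT br3.
  by apply: measurable_fun_ifT => //; exact: measurable_fun_ifT.
(* A branch number read from a letter is replaced by tests on the letter, so that measurability
   follows by cases. *)
rewrite (_ : K_beta beta = fun x =>
  if inE0 beta x.2 then (x.1, bmap beta 0 x.2)
  else if inE1 beta x.2 then (x.1, bmap beta 1 x.2)
  else if inE2 beta x.2 then (x.1, bmap beta 2 x.2)
  else if inC01 beta x.2 then ((Defs.shift x.1.1, x.1.2), br 0%N 1%N x)
  else if inC12 beta x.2 then ((Defs.shift x.1.1, x.1.2), br 1%N 2%N x)
  else if inC02 beta x.2 then ((Defs.shift x.1.1, x.1.2), br 0%N 2%N x)
  else if inC012 beta x.2 then ((x.1.1, Defs.shift x.1.2), br3 x)
  else x); last first.
  apply/funext => -[[w u] z]; rewrite /K_beta /br /br3 /=.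
  have br3E : bmap beta (nat_of_ord (u 0%N)) z =
      if nat_of_ord (u 0%N) == 0%N then bmap beta 0 z
      else if nat_of_ord (u 0%N) == 1%N then bmap beta 1 z
      else bmap beta 2 z.
    by case: (u 0%N) => -[|[|[|]]].
  rewrite br3E -!(fun_if (fun i => bmap beta i z)).
  by do 7 (case: ifP => // _); case: ifP.
have mle (f g : (Omega * Upsilon) * (R * R) -> R) :
    measurable_fun setT f -> measurable_fun setT g ->
    measurable_fun setT (fun x => f x <= g x) by exact: measurable_fun_ler.
have mlt (f g : (Omega * Upsilon) * (R * R) -> R) :
    measurable_fun setT f -> measurable_fun setT g ->
    measurable_fun setT (fun x => f x < g x) by exact: measurable_fun_ltr.
have mpair f g : measurable_fun [set: (Omega * Upsilon) * (R * R)] f ->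
    measurable_fun [set: (Omega * Upsilon) * (R * R)] g ->
    measurable_fun [set: (Omega * Upsilon) * (R * R)]
      (fun x => (f x, g x) : (Omega * Upsilon) * (R * R)).
  by move=> mf mg; apply/measurable_fun_pairP.
have mc (r : R) : measurable_fun [set: (Omega * Upsilon) * (R * R)] (fun=> r).
  exact: measurable_cst.
rewrite /inE0 /inE1 /inE2 /inC01 /inC12 /inC02 /inC012.
do 7 (apply: measurable_fun_ifT; [do ?apply: measurable_and;
  first [exact: mle|exact: mlt]|exact: mpair|]).
exact: measurable_id.
Qed.

End invariance.

End averaged_K_beta.

Theorem theorem5p7 (R : realType) (p s t beta : R)
  (hp0 : 0 < p) (hp1 : p < 1) (hs : 0 < s) (ht : 0 < t) (hst : s + t < 1)
  (m1 : probability Omega R) (m2 : probability Upsilon R)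
  (hm1 : is_product_measure (wt1 p) m1)
  (hm2 : is_product_measure (wt2 s t) m2)
  (hb1 : 1 < beta) (hb2 : beta < 3 / 2) :
  exists mu : probability (R * R)%type R,
    mu (S_beta beta) = 1%E /\
    mu `<< lambda2 beta /\
    invariant_measure (K_beta beta) ((m1 \x m2) \x mu)%E.
Proof.
have mS : measurable (S_beta beta) := measurable_S_beta beta.
have [mu [muS muac stat]] := stationary_measure hb1
  (branch_weight_ge0 hp0 hp1 hs ht hst) (branch_weight_sum p s t) mS
  (S_beta_finite beta) (square_sub_S_beta hb1 hb2)
  (@S_beta_invariant R p s t beta hb1 hb2).
exists mu; split => //; split.
  (* The normalizing factor of [lambda2] is nonzero, so a [lambda2]-null set meets the triangle in a
     set of zero area. *)
  move=> A A0 B mB BA; apply: muac => //.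
  have := A0 B mB BA; rewrite /lambda2 => /eqP; rewrite mule_eq0.
  case/orP => [|/eqP//]; rewrite eqe mulf_eq0 pnatr_eq0/= expf_eq0/=.
  by rewrite subr_eq0 gt_eqF.
split; first exact: measurable_K_beta.
move=> A mA; set m12 := (m1 \x m2)%E.
pose P12 := @Probability.clone _ _ R (m1 \x m2)%E _.
have mKA : measurable (K_beta beta @^-1` A).
  by rewrite -[X in measurable X]setTI; exact: measurable_K_beta.
pose g (z : R * R) := fine (m12 (ysection A z)).
have fg z : (g z)%:E = m12 (ysection A z).
  by rewrite /g fineK//; apply: product_measure_fin_num; exact: measurable_ysection.
have g01 z : 0 <= g z <= 1.
  rewrite -!lee_fin fg measure_ge0/=.
  by apply: product_measure_le1; exact: measurable_ysection.
have mg : measurable_fun [set: R * R] g.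
  apply: measurableT_comp => //; exact: (measurable_fun_ysection P12 mA).
have bg := bm_unit mg g01.
transitivity (\int[mu]_z m12 (ysection (K_beta beta @^-1` A) z))%E.
  exact: (product_measure_swap P12 mu mKA).
transitivity (\int[mu]_z m12 (ysection A z))%E; last first.
  exact/esym/(product_measure_swap P12 mu mA).
transitivity (\int[mu]_z (markov beta beta^-1 (beta * (beta - 1))^-1
    (branch_weight p s t) g z)%:E)%E.
  (* The section formula is available on the triangle only, which carries all of [mu]. *)
  apply: ae_eq_integral => //.
  - exact: (measurable_fun_ysection P12 mKA).
  - by apply/measurable_EFinP; have [] := bm_markov beta beta^-1
      (beta * (beta - 1))^-1 (branch_weight p s t) bg.
  exists (~` S_beta beta); split; first exact: measurableC.
    by rewrite /= probability_setC// muS subee.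
  move=> z /= h Sz; apply: h => _.
  exact: (K_beta_section hp0 hp1 hs ht hst hm1 hm2 Sz mA).
rewrite -EFin_expect; last exact: (bm_markov _ _ _ _ bg).
rewrite stat// EFin_expect//.
by apply: eq_integral => z _; rewrite fg.
Qed.
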